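(* Let $d\in\mathbb{N}$, let $I$ be a denumerable set and let $(x_i,r_i)_{i\in I}$ be a heterogeneous ubiquitous system with respect to $(\mu,\alpha,\beta,\varphi)\in\mathfrak{M}\times(0,\infty)\times(0,d]\times\Phi$. For $\psi\in\Psi$ and $M\in[1,\infty)$, let $I^{\mu,\alpha}_{M,\psi}$ be the set of all $i\in I$ such that $$M^{-1}(2r_i)^{\alpha+\psi(2r_i)}\le\mu(B(x_i,r_i))\le\mu(\bar B(x_i,r_i))\le M(2r_i)^{\alpha-\psi(2r_i)},$$ and, for $t\in[1,\infty)$, let $$\tilde E_t=\{x\in[0,1]^d : \|x-x_i\|<r_i^{\,t}\text{ for infinitely many }i\in I^{\mu,\alpha}_{M,\psi}\},$$ $$E_t=\mathbb{Z}^d+\tilde E_t=\{x\in\mathbb{R}^d : \|x-p-x_i\|<r_i^{\,t}\text{ for infinitely many }(i,p)\in I^{\mu,\alpha}_{M,\psi}\times\mathbb{Z}^d\}.$$ Then there exist $\psi\in\Psi$ and $M\in[1,\infty)$ such that: (1) $\tilde E_1\in \mathrm{G}^{h_{\beta,\varphi}}((0,1)^d)$ and $E_1\in \mathrm{G}^{h_{\beta,\varphi}}(\mathbb{R}^d)$; (2) for all $t\ge 1$ and all $\phi\in\Phi$, $\tilde E_t\in \mathrm{G}^{h_{\beta/t,2\varphi+\phi}}((0,1)^d)$ and $E_t\in \mathrm{G}^{h_{\beta/t,2\varphi+\phi}}(\mathbb{R}^d)$.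
   Context: $\mathbb{R}^d$ is endowed with the supremum norm $\|\cdot\|$; $B(x,r)$ and $\bar B(x,r)$ are the open and closed balls; $|\cdot|$ applied to a set denotes its diameter. Gauge functions. $\mathfrak{D}_d$ is the set of all functions $h$ that vanish at zero, are continuous and nondecreasing on $[0,\varepsilon]$ and are such that $r\mapsto h(r)/r^d$ is positive and nonincreasing on $(0,\varepsilon]$, for some $\varepsilon>0$ (only behaviour near zero matters). For $g,h\in\mathfrak{D}_d$, $g\prec h$ means that $g/h$ monotonically tends to infinity at zero. $c$-adic cubes. For an integer $c\ge2$, $\Lambda_c$ is the collection of $c$-adic cubes $\lambda^c_{j,k}=c^{-j}(k+[0,1)^d)$, $j\in\mathbb{Z}$, $k\in\mathbb{Z}^d$; $j$ is the generation of $\lambda^c_{j,k}$. For $x\in\mathbb{R}^d$, $\lambda^c_j(x)$ is the $c$-adic cube of generation $j$ containing $x$; $3\lambda$ is the cube obtained by expanding $\lambda$ by a factor $3$ about its center. Large intersection classes. For $h\in\mathfrak{D}_d$ let $\varepsilon_h$ be the supremum of all $\varepsilon\in(0,1]$ such that $h$ is continuous and nondecreasing on $[0,\varepsilon]$ and $h(r)/r^d$ is positive and nonincreasing on $(0,\varepsilon]$. For $F\subseteq\mathbb{R}^d$, $\mathcal{M}^h_\infty(F)=\inf\sum_{p\ge1}h(|\lambda_p|)$, the infimum being over all sequences $(\lambda_p)_{p\in\mathbb{N}}$ in $\Lambda_c\cup\{\emptyset\}$ with $F\subseteq\bigcup_p\lambda_p$ and $|\lambda_p|<\varepsilon_h$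 for all $p$. For a nonempty open $V\subseteq\mathbb{R}^d$, $\mathrm{G}^h(V)$ is the collection of all $G_\delta$-subsets $F$ of $\mathbb{R}^d$ such that $\mathcal{M}^g_\infty(F\cap U)=\mathcal{M}^g_\infty(U)$ for every $g\in\mathfrak{D}_d$ with $g\prec h$ and every open $U\subseteq V$. (It is known that $\mathrm{G}^h(V)$ depends on neither $c$ nor the norm.) $\Phi$ is the set of all functions $\varphi$ that are continuous and nondecreasing on $[0,\rho]$ for some $\rho>0$, vanish at zero, are such that $r^{-\varphi(r)}$ monotonically tends to infinity as $r\to0$, and are such that for every $\varepsilon>0$ the function $r\mapsto r^{\varepsilon-\varphi(r)}$ tends to zero at zero and increases in $(0,\rho_\varepsilon]$ for some $\rho_\varepsilon>0$. For $\beta\in(0,d]$ and $\varphi\in\Phi$, $h_{\beta,\varphi}(r)=r^{\beta-\varphi(r)}$ (with value $0$ at $0$), which belongs to $\mathfrak{D}_d$. $\Psi$ is the set of all functions $\psi$ that are continuous and nondecreasing on $[0,\rho]$ for some $\rho>0$, vanish at zero and are such that $r\mapsto r^{-\psi(r)}$ is nonincreasing on $(0,\rho]$. Values of these functions away from zero are irrelevant. $\mathfrak{M}$ is the set of all finite Borel measures with support $[0,1]^d$. $\mathcal{S}^0_d(I)$ is the set of all families $(x_i,r_i)_{i\in I}$ in $[0,1]^d\times(0,\infty)$ such that for every $\varepsilon>0$ at most finitely many $i\in I$ satisfy $r_i>\varepsilon$. Heterogeneous ubiquitous system. For a $c$-adic cube $\lambda\subseteq[0,1)^d$, $\omega_\lambda$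 is the dilation ($x\mapsto ax+b$ with $a>0$, $b\in\mathbb{R}^d$) mapping $\lambda$ onto $[0,1)^d$, and $m^\lambda=m\circ\omega_\lambda$, i.e. $m^\lambda(B)=m(\omega_\lambda(B))$ for Borel $B\subseteq\lambda$. A family $(x_i,r_i)_{i\in I}\in\mathcal{S}^0_d(I)$ is a heterogeneous ubiquitous system with respect to $(\mu,\alpha,\beta,\varphi)\in\mathfrak{M}\times(0,\infty)\times(0,d]\times\Phi$ if there are $\psi\in\Psi$, $m\in\mathfrak{M}$ and an integer $c\ge2$ such that: (i) for $m$-almost every $x\in[0,1]^d$ there are infinitely many $i\in I$ with $\|x-x_i\|\le r_i/2$; (ii) for $m$-almost every $x\in[0,1]^d$ there is an integer $j(x)$ such that for all integers $j\ge j(x)$ and all $k\in\{0,\dots,c^j-1\}^d$ with $\lambda^c_{j,k}\subseteq3\lambda^c_j(x)$, $m(\lambda^c_{j,k})\le h_{\beta,\varphi}(|\lambda^c_{j,k}|)$; (iii) for $m$-almost every $x\in[0,1]^d$ there is an integer $j(x)$ such that for all integers $j\ge j(x)$ and all $k\in\{0,\dots,c^j-1\}^d$ with $\lambda^c_{j,k}\subseteq3\lambda^c_j(x)$, $|\lambda^c_{j,k}|^{\alpha+\psi(|\lambda^c_{j,k}|)}\le\mu(\lambda^c_{j,k})\le|\lambda^c_{j,k}|^{\alpha-\psi(|\lambda^c_{j,k}|)}$; (iv) for every $c$-adic cube $\lambda\subseteq[0,1)^d$, the measure $m^\lambda$ and the restriction of $m$ to $\lambda$ are absolutely continuous with respect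 to one another. *)

(* Defs.v *)
From HB Require Import structures.
From mathcomp Require Import all_boot all_order all_algebra.
From mathcomp Require Import all_classical all_reals all_analysis.
From mathcomp Require Import borel_hierarchy zify.
Set Implicit Arguments.
Unset Strict Implicit.
Unset Printing Implicit Defensive.
Import Order.TTheory GRing.Theory Num.Theory.
Import numFieldNormedType.Exports.
Local Open Scope classical_set_scope.
Local Open Scope ring_scope.

(* R^d is 'rV[R]_d: its library norm `|x| is the supremum norm, and [ball] and
   [closed_ball] are the open and closed balls of that norm.  The Borel
   sigma-algebra is the one generated by the open sets. *)
Notation borel R d := (g_sigma_algebraType (@open 'rV[R]_d)).

Section Space.
Context {R : realType} {d : nat}.
Implicit Types (x : 'rV[R]_d) (k : 'rV[int]_d).

(* 0 on the empty set and on unbounded sets; only used on bounded sets. *)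
Definition diam (A : set 'rV[R]_d) : R :=
  sup [set `|y.1 - y.2| | y in A `*` A].

Definition ccube : set 'rV[R]_d := [set x | forall i, 0 <= x ord0 i <= 1].
Definition ocube : set 'rV[R]_d := [set x | forall i, 0 < x ord0 i < 1].
Definition hcube : set 'rV[R]_d := [set x | forall i, 0 <= x ord0 i < 1].

Definition zvec k : 'rV[R]_d := map_mx intr k.

Definition cadic (c : nat) (j : int) k : set 'rV[R]_d :=
  [set (c%:R : R) ^ (- j) *: (zvec k + y) | y in hcube].

Definition cadic_center (c : nat) (j : int) k : 'rV[R]_d :=
  (c%:R : R) ^ (- j) *: (zvec k + const_mx 2^-1).

Definition cadic3 (c : nat) (j : int) k : set 'rV[R]_d :=
  [set cadic_center c j k + 3 *: (y - cadic_center c j k) | y in cadic c j k].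

(* The index of the cube of generation j containing x; see [cadicP]. *)
Definition cadic_index (c : nat) (j : int) x : 'rV[int]_d :=
  map_mx (fun u => Num.floor ((c%:R : R) ^ j * u)) x.

Lemma cadicP (c : nat) (j : int) k x : (0 < c)%N ->
  cadic c j k x <-> k = cadic_index c j x.
Proof.
move=> c0; have cj0 : (c%:R : R) ^ j != 0 by rewrite expfz_neq0 // pnatr_eq0 -lt0n.
split=> [[y hy <-]|->].
  apply/rowP => i; rewrite !mxE -invr_expz mulVKf //.
  have /andP[y0 y1] := hy i; apply/esym/floor_def.
  by rewrite lerDl y0 /= intrD1 ltrD2l.
exists ((c%:R : R) ^ j *: x - zvec (cadic_index c j x)).
  move=> i; rewrite !mxE subr_ge0 ltrBlDl -intrD1.
  exact: floor_itv.
by rewrite addrC subrK scalerA -invr_expz mulVf // scale1r.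
Qed.

(* The dilation x |-> c^j x - k; see [cadic_dilation_image]. *)
Definition cadic_dilation (c : nat) (j : int) k x : 'rV[R]_d :=
  (c%:R : R) ^ j *: x - zvec k.

Lemma cadic_dilation_image (c : nat) (j : int) k : (0 < c)%N ->
  cadic_dilation c j k @` cadic c j k = hcube.
Proof.
move=> c0; have cj0 : (c%:R : R) ^ j != 0 by rewrite expfz_neq0 // pnatr_eq0 -lt0n.
have E y : cadic_dilation c j k ((c%:R : R) ^ (- j) *: (zvec k + y)) = y.
  by rewrite /cadic_dilation scalerA -invr_expz mulfV // scale1r addrC addKr.
apply/seteqP; split=> [_ [_ [y hy <-] <-]|y hy]; first by rewrite E.
by exists ((c%:R : R) ^ (- j) *: (zvec k + y)); [exists y | rewrite E].
Qed.

Definition msupport (mu : set (borel R d) -> \bar R) : set 'rV[R]_d :=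
  [set x | forall U : set 'rV[R]_d, open U -> U x -> (0 < mu U)%E].

Definition ubiq_measure (mu : {finite_measure set (borel R d) -> \bar R}) :=
  msupport mu = ccube.

End Space.

Section Gauges.
Context {R : realType}.
Implicit Types (h g phi psi : R -> R) (e : R).

(* Functions on [0, +oo) are total functions R -> R whose values at negative
   (and, as only germs at 0+ matter, at large) arguments are irrelevant. *)

Definition continuous_nondecreasing_upto h e :=
  {within `[0, e]%classic, continuous h} /\
  {in `[0, e] &, {homo h : r s / r <= s}}.

Definition gauge_upto (d : nat) h e :=
  [/\ continuous_nondecreasing_upto h e,
      {in `]0, e], forall r, 0 < h r / r ^+ d} &
      {in `]0, e] &, {homo (fun r => h r / r ^+ d) : r s /~ r <= s}}].

Definition gauge (d : nat) h :=
  h 0 = 0 /\ exists2 e, 0 < e & gauge_upto d h e.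

Definition monotonically_to_pinfty_at0 (f : R -> R) :=
  f r @[r --> 0^'+] --> +oo /\
  exists2 e, 0 < e & {in `]0, e] &, {homo f : r s /~ r <= s}}.

Definition gauge_prec g h := monotonically_to_pinfty_at0 (fun r => g r / h r).

Definition eps_gauge (d : nat) h : R :=
  sup [set e | 0 < e <= 1 /\ gauge_upto d h e].

Definition PhiClass phi :=
  [/\ exists2 rho, 0 < rho & continuous_nondecreasing_upto phi rho,
      phi 0 = 0,
      monotonically_to_pinfty_at0 (fun r => r `^ (- phi r)) &
      forall e, 0 < e ->
        r `^ (e - phi r) @[r --> 0^'+] --> 0 /\
        exists2 rho, 0 < rho &
          {in `]0, rho] &, {homo (fun r => r `^ (e - phi r)) : r s / r < s}}].

Definition PsiClass psi :=
  psi 0 = 0 /\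
  exists rho, [/\ 0 < rho, continuous_nondecreasing_upto psi rho &
    {in `]0, rho] &, {homo (fun r => r `^ (- psi r)) : r s /~ r <= s}}].

Definition hgauge (beta : R) phi : R -> R :=
  fun r => if r == 0 then 0 else r `^ (beta - phi r).

End Gauges.

Section LargeIntersection.
Context {R : realType} {d : nat}.
Implicit Types (h : R -> R) (F V : set 'rV[R]_d).

Definition cadic_or_empty (c : nat) (A : set 'rV[R]_d) :=
  A = set0 \/ exists j k, A = cadic c j k.

Definition net_premeasure (c : nat) h F : \bar R :=
  ereal_inf [set (\sum_(0 <= p <oo) (h (diam (lam p)))%:E)%E |
    lam in [set lam : (set 'rV[R]_d)^nat |
      [/\ forall p, cadic_or_empty c (lam p),
          F `<=` \bigcup_p lam p &
          forall p, diam (lam p) < eps_gauge d h]]].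

(* Membership of F in the class G^h(V), for nonempty open V; the class is known
   not to depend on the integer c >= 2 used to define the net premeasure. *)
Definition large_intersection (c : nat) h V F :=
  Gdelta F /\
  forall g, gauge d g -> gauge_prec g h ->
  forall U, open U -> U `<=` V ->
    net_premeasure c g (F `&` U) = net_premeasure c g U.

End LargeIntersection.

Section Ubiquity.
Context {R : realType} {d : nat} {I : Type}.
Variables (xs : I -> 'rV[R]_d) (rs : I -> R).
Implicit Types (m mu : {finite_measure set (borel R d) -> \bar R}).

Definition null_family :=
  (forall i, ccube (xs i) /\ 0 < rs i) /\
  forall e, 0 < e -> finite_set [set i | e < rs i].

(* The property P j k holds for all large j and all cubes of generation j in
   [0,1)^d that are contained in the tripled cube of generation j around x. *)
Definition eventually_near (c : nat) (x : 'rV[R]_d)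
    (P : int -> 'rV[int]_d -> Prop) :=
  exists j0 : int, forall j : int, j0 <= j ->
  forall k : 'rV[int]_d,
    (forall i, 0 <= k ord0 i /\ (k ord0 i)%:~R <= (c%:R : R) ^ j - 1) ->
    (cadic c j k : set 'rV[R]_d) `<=` cadic3 c j (cadic_index c j x) ->
    P j k.

Definition heterogeneous_ubiquitous_with mu (alpha beta : R) (phi psi : R -> R)
    m (c : nat) :=
  [/\ {ae m, forall x : 'rV[R]_d, ccube x ->
        infinite_set [set i | `|x - xs i| <= rs i / 2]},
      {ae m, forall x : 'rV[R]_d, ccube x ->
        eventually_near c x (fun j k =>
          (m (cadic c j k) <= (hgauge beta phi (diam (cadic c j k)))%:E)%E)},
      {ae m, forall x : 'rV[R]_d, ccube x ->
        eventually_near c x (fun j k =>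
          let delta := diam (cadic c j k) in
          ((delta `^ (alpha + psi delta))%:E <= mu (cadic c j k))%E /\
          (mu (cadic c j k) <= (delta `^ (alpha - psi delta))%:E)%E)} &
      forall j k, cadic c j k `<=` (hcube : set 'rV[R]_d) ->
        let m_dil := fun B : set (borel R d) =>
          m (cadic_dilation c j k @` (B `&` cadic c j k)) in
        let m_res := fun B : set (borel R d) => m (B `&` cadic c j k) in
        m_dil `<< m_res /\ m_res `<< m_dil].

Definition heterogeneous_ubiquitous mu (alpha beta : R) (phi : R -> R) :=
  null_family /\
  exists (psi : R -> R) m (c : nat),
    [/\ PsiClass psi, ubiq_measure m, (2 <= c)%N &
        heterogeneous_ubiquitous_with mu alpha beta phi psi m c].

Definition scaling_indices mu (alpha M : R) (psi : R -> R) : set I :=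
  [set i | let s := 2 * rs i in
    [/\ ((M^-1 * s `^ (alpha + psi s))%:E <= mu (ball (xs i) (rs i)))%E,
        (mu (ball (xs i) (rs i)) <= mu (closed_ball (xs i) (rs i)))%E &
        (mu (closed_ball (xs i) (rs i)) <= (M * s `^ (alpha - psi s))%:E)%E]].

Definition limsup_cube mu (alpha M : R) (psi : R -> R) (t : R) : set 'rV[R]_d :=
  [set x | ccube x /\ infinite_set
    [set i | scaling_indices mu alpha M psi i /\ `|x - xs i| < rs i `^ t]].

Definition limsup_per mu (alpha M : R) (psi : R -> R) (t : R) : set 'rV[R]_d :=
  [set zvec p + y | p in [set: 'rV[int]_d] & y in limsup_cube mu alpha M psi t].

Lemma coord_le_norm (y : 'rV[R]_d) i : `|y ord0 i| <= `|y|.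
Proof.
rewrite [leRHS]/Num.norm /= mx_normrE; apply/bigmax_geP; right => /=.
by exists (ord0, i).
Qed.

Lemma finite_zvec_bounded (B : R) :
  finite_set [set p : 'rV[int]_d | `|zvec p : 'rV[R]_d| <= B].
Proof.
pose N := `|Num.ceil B|%N.
have BN : B <= N%:~R.
  apply: le_trans (Num.Theory.ceil_ge B) _; rewrite ler_int.
  by rewrite /N abszE ler_norm.
pose f (q : 'rV['I_(2 * N).+1]_d) : 'rV[int]_d :=
  \row_i ((q ord0 i : nat)%:Z - N%:Z).
apply: (@sub_finite_set _ _ (f @` setT)); last first.
  by apply: finite_image; exact: finite_finset.
move=> p /= pB; exists (\row_i inord (absz (p ord0 i + N%:Z))) => //.
apply/rowP => i; rewrite !mxE.
have : `|p ord0 i| <= N%:Z.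
  rewrite -(ler_int R) intr_norm (le_trans _ BN)// (le_trans _ pB)//.
  by have := coord_le_norm (zvec p) i; rewrite mxE.
rewrite ler_norml => /andP[lo hi]; move: (p ord0 i) lo hi => u lo hi; rewrite inordK; lia.
Qed.

Lemma limsup_perE mu (alpha M : R) (psi : R -> R) (t : R) :
  null_family -> 0 < t ->
  limsup_per mu alpha M psi t =
  [set x | infinite_set [set ip : I * 'rV[int]_d |
    scaling_indices mu alpha M psi ip.1 /\
    `|x - zvec ip.2 - xs ip.1| < rs ip.1 `^ t]].
Proof.
move=> [xsr rs0] t0; apply/seteqP; split=> [_ [p _ [y [_ yinf]] <-] fin|x xinf].
  apply: yinf; set S := (X in finite_set X) in fin.
  apply: (@sub_finite_set _ _ (fst @` S)); last exact: finite_image.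
  by move=> i Si; exists (i, p) => //; rewrite /S /= [zvec p + y]addrC addrK.
pose S p := [set i | scaling_indices mu alpha M psi i /\
                     `|x - zvec p - xs i| < rs i `^ t].
have [p pinf] : exists p, infinite_set (S p).
  apply: contrapT => /forallNP Sfin; apply: xinf.
  have normp i (p : 'rV[int]_d) : `|x - zvec p - xs i| < rs i `^ t ->
      `|zvec p : 'rV[R]_d| <= `|x| + `|xs i| + rs i `^ t.
    move=> h; have -> : zvec p = x - xs i - (x - zvec p - xs i) :> 'rV[R]_d.
      by rewrite [x - zvec p - xs i]addrAC subKr.
    by rewrite (le_trans (ler_normB _ _))// lerD ?ler_normB// ltW.
  pose P i := [set p : 'rV[int]_d | `|zvec p : 'rV[R]_d| <=
                                     `|x| + `|xs i| + rs i `^ t].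
  pose Q := [set p : 'rV[int]_d | `|zvec p : 'rV[R]_d| <= `|x| + 1 + 1] `|`
            \bigcup_(i in [set i | 1 < rs i]) P i.
  apply: (@sub_finite_set _ _ (\bigcup_(p in Q) ((fun i => (i, p)) @` S p))).
    move=> [i p] /= [si xi]; exists p; last by exists i.
    have [ri|ri] := ltP 1 (rs i); first by right; exists i => //; exact: normp.
    left => /=; apply: le_trans (normp _ _ xi) _; rewrite lerD// ?lerD//.
      rewrite [leLHS]/Num.norm /= mx_normrE; apply/bigmax_leP; split=> //= -[a b] _.
      by rewrite /= ord1 ger0_norm; have [/(_ b)/andP[]] := xsr i.
    have [_ r0] := xsr i.
    by rewrite -(powRr0 (rs i)) ger_powR ?ri ?r0// ltW.
  apply: bigcup_finite => [|p _]; last first.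
    by apply: finite_image; have /contrapT := Sfin p.
  rewrite finite_setU; split; first exact: finite_zvec_bounded.
  apply: bigcup_finite; first exact: rs0.
  by move=> i _; exact: finite_zvec_bounded.
exists p => //; exists (x - zvec p); last by rewrite addrC subrK.
split => //; apply: contrapT => /existsNP[i /negP yi]; apply: pinf.
set y := (x - zvec p) ord0 i in yi.
have [e e0 ye] : exists2 e, 0 < e & forall z : R, 0 <= z <= 1 -> e <= `|y - z|.
  move: yi; rewrite negb_and -!ltNge => /orP[y0|y1].
    exists (- y); first by rewrite oppr_gt0.
    by move=> z /andP[z0 _]; rewrite distrC (le_trans _ (ler_norm _))// lerDr.
  exists (y - 1); first by rewrite subr_gt0.
  by move=> z /andP[_ z1]; rewrite (le_trans _ (ler_norm _))// lerB.
apply: (@sub_finite_set _ _ [set i | e `^ t^-1 / 2 < rs i]); last first.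
  by apply: rs0; rewrite divr_gt0 ?powR_gt0.
move=> k [_ xk] /=; have [xk01 rk] := xsr k.
have ert : e < rs k `^ t.
  apply: le_lt_trans xk; apply: le_trans (ye _ (xk01 i)) _.
  by have := coord_le_norm (x - zvec p - xs k) i; rewrite 3!mxE /y !mxE.
rewrite (@lt_le_trans _ _ (e `^ t^-1))//.
  by rewrite ltr_pdivrMr// ltr_pMr ?powR_gt0// ltr1n.
have -> : rs k = (rs k `^ t) `^ t^-1.
  by rewrite -powRrM mulfV ?gt_eqF// powRr1// ltW.
by rewrite ge0_ler_powR ?nnegrE ?invr_ge0 ?powR_ge0 ?(ltW t0) ?(ltW e0) ?(ltW ert).
Qed.

End Ubiquity.

(* Main.v *)
Require Import Defs.
From HB Require Import structures.
From mathcomp Require Import all_boot all_order all_algebra.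
From mathcomp Require Import all_classical all_reals all_analysis.
From mathcomp Require Import borel_hierarchy ring lra zify.
Set Implicit Arguments.
Unset Strict Implicit.
Unset Printing Implicit Defensive.
Import Order.TTheory GRing.Theory Num.Theory.
Import numFieldNormedType.Exports.
Local Open Scope classical_set_scope.
Local Open Scope card_scope.
Local Open Scope ring_scope.

(* Fix a gauge g >> h_{beta/t,phi} and let h = h_{beta,phi}; then g >> h, and
   g (r^t) >> h r at zero.  It suffices to distribute a unit mass over finitely
   many tiny b-adic subcubes of any given cube lam, each inside a ball
   B(x_i, r_i^t) with i large, so that every b-adic subcube Q of lam receives mass
   at most g|Q| / g|lam|, with constant exactly 1.  Indeed, given a b-adic cover of
   limsup B(x_i, r_i^t) inside lam that costs less than g|lam|, the mass bound forces
   one of the tiny cubes to have the same defect; iterating, the nested cubes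
   shrink to a point of the limsup set that the cover misses.

   To build the masses, restrict m to a set G of positive measure on which
   m(Q) <= h|Q| for all small c-adic cubes Q, and choose a small c-adic cube mu
   almost maximizing m(G /\ Q) / h|Q|: the normalized restriction of m to G /\ mu
   gives Q mass at most 2 h|Q| / h|mu|.  Subdivide lam evenly into b-adic cubes of
   size comparable to |mu| and translate that restriction into each of them; by
   (iv) almost all of its mass sits at points lying in infinitely many balls
   B(x_i, r_i / 2), and a greedy choice of well separated balls lets one push the
   mass of B(x_i, r_i) into a single cube of size about r_i^t.  As g >> h, all
   multiplicative constants are absorbed at small scales. *)

(** * b-adic cubes *)

(** Membership in a large intersection class is an equality of premeasures, and the descent to a
    limit point has infinitely many steps, so no factor may be lost at a step. This is why the mass
    bound must have constant 1 and why scales are chosen after all constants. The obstacle is that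
    (ii) only holds from a generation depending on the point, and (iv) is absolute continuity
    without any quantitative comparison: inside a prescribed cube, [m] may be tiny or badly spread.
    So [m] on that cube is never measured. One well spread piece of [m], found anywhere at a small
    scale, is copied into all its parts, and (iv) only carries null sets from one cube to another.
    At scales coarser than the copies the mass is proportional to volume, which is below [g] since
    g(r)/r^d is nonincreasing. At finer scales g/h must beat a constant; as r^d/h(r) is
    nondecreasing, that constant can be bounded before the scale of the piece is known. The base [b]
    of the premeasure is arbitrary while [c] comes from the system. The two grids are unrelated, so
    copies are placed in b-adic cubes with a margin. *)

Section SupNorm.
Context {R : realType} {d : nat}.
Implicit Types (x y : 'rV[R]_d) (e : R).

Lemma norm_leP x e : 0 <= e -> (`|x| <= e <-> forall i, `|x ord0 i| <= e).
Proof.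
move=> e0; split=> [h i|h]; first exact: le_trans (coord_le_norm x i) h.
rewrite [leLHS]/Num.norm /= mx_normrE; apply/bigmax_leP; split=> // -[a b] _ /=.
by rewrite ord1.
Qed.

Lemma norm_ltP x e : 0 < e -> (`|x| < e <-> forall i, `|x ord0 i| < e).
Proof.
move=> e0; split=> [h i|h]; first exact: le_lt_trans (coord_le_norm x i) h.
rewrite [ltLHS]/Num.norm /= mx_normrE; apply/bigmax_ltP; split=> // -[a b] _ /=.
by rewrite ord1.
Qed.

End SupNorm.

Section Cubes.
Context {R : realType} {d : nat}.
Implicit Types (x y : 'rV[R]_d) (k p : 'rV[int]_d) (b n : nat).

(** Generations are restricted to natural numbers: [eps_gauge] is at most 1, and a cube of negative
    generation has diameter at least 1, so it never occurs in an admissible cover. *)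
Definition cube b n k : set 'rV[R]_d := cadic b n%:Z k.
Definition cubeidx b n x : 'rV[int]_d := cadic_index b n%:Z x.

Lemma cubeP b n k x : (0 < b)%N -> cube b n k x <-> k = cubeidx b n x.
Proof. exact: cadicP. Qed.

Lemma cube_self b n x : (0 < b)%N -> cube b n (cubeidx b n x) x.
Proof. by move=> b0; apply/cubeP. Qed.

Lemma cubeidxE b n x i : cubeidx b n x ord0 i = Num.floor (b%:R ^+ n * x ord0 i).
Proof. by rewrite !mxE. Qed.

Lemma cubeE b n k x : (0 < b)%N -> cube b n k x <->
  forall i, (k ord0 i)%:~R <= b%:R ^+ n * x ord0 i < (k ord0 i)%:~R + 1.
Proof.
move=> b0; rewrite cubeP//; split=> [-> i|h].
  by rewrite cubeidxE -intrD1; exact: floor_itv.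
by apply/rowP => i; rewrite cubeidxE; apply/esym/floor_def; rewrite intrD1.
Qed.

(** The fine floor determines the coarse one: an integer z is at most u / B iff the integer z * B is
    at most the floor of u. *)
Lemma cubeidx_coarse b n1 n2 x y : (0 < b)%N -> (n1 <= n2)%N ->
  cubeidx b n2 x = cubeidx b n2 y -> cubeidx b n1 x = cubeidx b n1 y.
Proof.
move=> b0 n12 h; apply/rowP => i; rewrite !cubeidxE.
have {h} := congr1 (fun k => k ord0 i) h; rewrite !cubeidxE => h.
set B : R := b%:R ^+ (n2 - n1).
have B0 : 0 < B by rewrite exprn_gt0 // ltr0n.
have E u : b%:R ^+ n1 * u = (b%:R ^+ n2 * u) / B :> R.
  by rewrite -(subnKC n12) exprD /B mulrAC mulfK// ?gt_eqF// mulrC addKn.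
have key (z : int) (u : R) :
    (z%:~R <= u / B) = ((z * b%:Z ^+ (n2 - n1)) <= Num.floor u).
  rewrite ler_pdivlMr// floor_ge_int rmorphM rmorphXn//=.
have K z : (z <= Num.floor (b%:R ^+ n1 * x ord0 i)) =
           (z <= Num.floor (b%:R ^+ n1 * y ord0 i)).
  by rewrite !floor_ge_int !E !key h.
by apply/eqP; rewrite eq_le -K lexx /= K lexx.
Qed.

Lemma cube_nested b n1 n2 k1 k2 x : (0 < b)%N -> (n1 <= n2)%N ->
  cube b n1 k1 x -> cube b n2 k2 x -> cube b n2 k2 `<=` cube b n1 k1.
Proof.
move=> b0 n12 /(cubeP _ _ _ b0) -> /(cubeP _ _ _ b0) -> y /(cubeP _ _ _ b0) h.
apply/cubeP => //; exact: cubeidx_coarse h.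
Qed.

Lemma cube_nonempty b n k : (0 < b)%N -> exists x, cube b n k x.
Proof.
move=> b0; exists (\row_i ((k ord0 i)%:~R / b%:R ^+ n)); apply/cubeE => // i.
by rewrite mxE mulrC divfK ?ltrDl ?lexx//= expf_neq0// pnatr_eq0 -lt0n.
Qed.

Lemma cube_inj b n k1 k2 x : (0 < b)%N ->
  cube b n k1 x -> cube b n k2 x -> k1 = k2.
Proof. by move=> b0 /(cubeP _ _ _ b0) -> /(cubeP _ _ _ b0) ->. Qed.

Lemma side_gt0 b n : (0 < b)%N -> 0 < (b%:R : R) ^- n.
Proof. by move=> b0; rewrite invr_gt0 exprn_gt0// ltr0n. Qed.

Lemma side_le b n1 n2 : (0 < b)%N -> (n1 <= n2)%N ->
  (b%:R : R) ^- n2 <= b%:R ^- n1.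
Proof.
move=> b0 n12; rewrite lef_pV2 ?posrE ?exprn_gt0 ?ltr0n//.
by rewrite ler_weXn2l// ler1n.
Qed.

Lemma side_leE b n1 n2 : (1 < b)%N ->
  ((b%:R : R) ^- n2 <= b%:R ^- n1) = (n1 <= n2)%N.
Proof.
move=> b1; rewrite lef_pV2 ?posrE ?exprn_gt0 ?ltr0n ?(ltnW b1)//.
by rewrite ler_eXn2l// ltr1n.
Qed.

Lemma sideS b n : (0 < b)%N -> (b%:R : R) ^- n = b%:R * b%:R ^- n.+1.
Proof. by move=> b0; rewrite exprS invfM mulrA mulfV ?mul1r// pnatr_eq0 -lt0n. Qed.

Lemma side_small b (e : R) : (1 < b)%N -> 0 < e -> exists n, b%:R ^- n < e.
Proof.
move=> b1 e0; have [n hn] : exists n, e^-1 < n%:R :> R.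
  by exists (Num.truncn e^-1).+1; rewrite truncnS_gt.
exists n; rewrite invf_plt ?posrE ?exprn_gt0 ?ltr0n ?(ltnW b1)//.
by rewrite (lt_le_trans hn)// -natrX ler_nat ltnW// ltn_expl.
Qed.

Lemma side_between b (e : R) : (1 < b)%N -> 0 < e -> e <= 1 ->
  exists n, b%:R ^- n <= e /\ e < b%:R * b%:R ^- n.
Proof.
move=> b1 e0 e1.
have ex : exists n, (b%:R : R) ^- n <= e.
  by have [n /ltW hn] := side_small b1 e0; exists n.
case: (ex_minnP ex) => -[|n] h1 hmin; [exists 0%N|exists n.+1]; split => //.
  by rewrite expr0 invr1 mulr1 (le_lt_trans e1)// ltr1n.
rewrite -sideS ?(ltnW b1)// real_ltNge ?num_real//; apply/negP => /hmin.
by rewrite ltnn.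
Qed.

Lemma side_between_gt b (e : R) : (1 < b)%N -> 0 < e -> e <= 1 ->
  exists n, e <= b%:R ^- n /\ b%:R ^- n < b%:R * e.
Proof.
move=> b1 e0 e1; have [n hn] := side_small b1 e0.
have ub i : (e <= (b%:R : R) ^- i) -> (i <= n)%N.
  by move=> ei; rewrite -(side_leE _ _ b1) ltW// (lt_le_trans hn).
have ex : exists i, e <= (b%:R : R) ^- i by exists 0%N; rewrite expr0 invr1.
case: (ex_maxnP ex ub) => i ei imax; exists i; split => //.
rewrite sideS ?(ltnW b1)// ltr_pM2l ?ltr0n ?(ltnW b1)//.
by rewrite real_ltNge ?num_real//; apply/negP => /imax; rewrite ltnn.
Qed.

Lemma cube_dist b n k x y : (0 < b)%N -> cube b n k x -> cube b n k y ->
  `|x - y| < b%:R ^- n.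
Proof.
move=> b0 /(cubeE _ _ _ b0) hx /(cubeE _ _ _ b0) hy.
apply/norm_ltP => [|i]; first exact: side_gt0.
have B0 : 0 < (b%:R : R) ^+ n by rewrite exprn_gt0 // ltr0n.
rewrite !mxE -(ltr_pM2l B0) mulfV ?gt_eqF// -{1}(gtr0_norm B0) -normrM mulrBr.
have := hx i; have := hy i; rewrite ltr_norml => /andP[? ?] /andP[? ?].
by apply/andP; split; lra.
Qed.

(** The cube is half-open, so the supremum is not attained; it is approached along the diagonal,
    from the corner [pt 0] to a point at distance exactly b^-n - e from it. *)
Lemma diam_cube b n k : (0 < d)%N -> (0 < b)%N ->
  diam (cube b n k) = b%:R ^- n.
Proof.
move=> d0 b0; have s0 := side_gt0 n b0.
have B0 : 0 < (b%:R : R) ^+ n by rewrite exprn_gt0 // ltr0n.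
pose pt (s : R) : 'rV[R]_d := \row_i (((k ord0 i)%:~R + s) / b%:R ^+ n).
have ptin s : 0 <= s < 1 -> cube b n k (pt s).
  move=> /andP[s0' s1]; apply/cubeE => // i; rewrite mxE mulrC divfK ?gt_eqF//.
  by rewrite lerDl s0' ltrD2l.
have ubS : ubound [set `|y.1 - y.2| | y in cube b n k `*` cube b n k] (b%:R ^- n).
  by move=> _ /= [[x y] [/= hx hy] <-]; apply/ltW/(cube_dist b0 hx hy).
apply/eqP; rewrite eq_le; apply/andP; split.
  apply: ge_sup => //; exists `|pt 0 - pt 0|, (pt 0, pt 0) => //.
  by split; apply: ptin; rewrite lexx ltr01.
apply/ler_addgt0Pr => e e0; rewrite -lerBlDr.
have [es|es] := lerP e (b%:R ^- n); last first.
  apply: le_trans (_ : 0 <= _); first by rewrite subr_le0 ltW.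
  apply: sup_ubound => /=; first by exists (b%:R ^- n).
  exists (pt 0, pt 0); last by rewrite subrr normr0.
  by split; apply: ptin; rewrite lexx ltr01.
set s := 1 - e * b%:R ^+ n.
have hs : 0 <= s < 1.
  rewrite subr_ge0 -ler_pdivlMr// div1r es/= ltrBlDr ltrDl mulr_gt0//.
apply: sup_ubound; first by exists (b%:R ^- n).
exists (pt s, pt 0) => /=.
  by split; apply: ptin => //; rewrite lexx ltr01.
have -> : pt s - pt 0 = const_mx (s / b%:R ^+ n).
  by apply/rowP => i; rewrite !mxE -mulrBl addr0 addrAC subrr add0r.
have -> : b%:R ^- n - e = s / b%:R ^+ n.
  by rewrite /s mulrBl mulfK ?gt_eqF// div1r.
apply/eqP; rewrite eq_le; apply/andP; split; last first.
  have := coord_le_norm (const_mx (s / b%:R ^+ n) : 'rV[R]_d) (Ordinal d0).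
  by rewrite mxE; apply: le_trans; exact: ler_norm.
have s0n : 0 <= s / b%:R ^+ n by rewrite divr_ge0 ?(ltW B0)//; case/andP: hs.
by apply/norm_leP => // i; rewrite mxE ger0_norm.
Qed.

Lemma cube_shift b n k p x : (0 < b)%N ->
  cube b n (k + b%:Z ^+ n *: p) (x + zvec p) <-> cube b n k x.
Proof.
move=> b0; rewrite !cubeE//; split=> h i; have := h i; rewrite !mxE.
  by rewrite rmorphD rmorphM rmorphXn/= mulrDr addrAC lerD2r ltrD2r.
by rewrite rmorphD rmorphM rmorphXn/= mulrDr addrAC lerD2r ltrD2r.
Qed.

Lemma hcubeE b : (0 < b)%N -> hcube = cube b 0 0.
Proof.
move=> b0; apply/seteqP; split=> x.
  by move=> h; apply/cubeE => // i; rewrite mxE expr0 mul1r add0r; exact: h.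
by move=> /(cubeE _ _ _ b0) h i; have := h i; rewrite mxE expr0 mul1r add0r.
Qed.

Lemma cube_sub_hcube b n k x : (0 < b)%N -> cube b n k x -> hcube x ->
  cube b n k `<=` hcube.
Proof.
by move=> b0; rewrite (hcubeE b0) => hx h0; exact: cube_nested h0 hx.
Qed.

End Cubes.

(** * Covers and the descent argument *)

Section NestedCubes.
Context {R : realType} {d : nat}.

(** Nested half-open cubes may have empty intersection, so the descent uses closed balls. For the
    supremum norm these are products of intervals, and the suprema of the left endpoints give a
    common point. *)
Lemma nested_balls (x : nat -> 'rV[R]_d) (s : nat -> R) :
  (forall n, 0 <= s n) ->
  (forall n, [set y | `|y - x n.+1| <= s n.+1] `<=` [set y | `|y - x n| <= s n]) ->
  exists y, forall n, `|y - x n| <= s n.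
Proof.
move=> s0 sub.
have subD n m : [set y | `|y - x (m + n)%N| <= s (m + n)%N] `<=`
    [set y | `|y - x n| <= s n].
  elim: m => [//|m ih]; apply: subset_trans ih; rewrite addSn; exact: sub.
have inn n m : (n <= m)%N -> `|x m - x n| <= s n.
  move=> nm; rewrite -(subnK nm); apply: (subD n (m - n)%N (x (m - n + n)%N)).
  by rewrite /= subrr normr0.
have cross i n m : x n ord0 i - s n <= x m ord0 i + s m.
  have [h1 h2] : `|x (maxn n m) - x n| <= s n /\ `|x (maxn n m) - x m| <= s m.
    by split; apply: inn; [exact: leq_maxl|exact: leq_maxr].
  have := le_trans (coord_le_norm _ i) h1; have := le_trans (coord_le_norm _ i) h2.
  by rewrite !mxE !ler_norml => /andP[? ?] /andP[? ?]; lra.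
pose E i := range (fun n => x n ord0 i - s n).
have ubE i n : ubound (E i) (x n ord0 i + s n).
  by move=> _ [m _ <-]; exact: cross.
exists (\row_i sup (E i)) => n; apply/norm_leP => // i; rewrite !mxE ler_norml.
apply/andP; split; last first.
  rewrite lerBlDl; apply: ge_sup; last exact: ubE.
  by exists (x n ord0 i - s n), n.
rewrite -lerBlDr opprK addrC; apply: sup_ubound; last by exists n.
by exists (x n ord0 i + s n); exact: ubE.
Qed.

End NestedCubes.

Section Costs.
Context {R : realType} {d : nat}.
Variables (Q : nat -> set 'rV[R]_d) (u : nat -> \bar R).
Hypothesis u_ge0 : forall p, (0 <= u p)%E.
Hypothesis u0 : forall p, Q p = set0 -> u p = 0%E.

(** What a cover [Q] with prices [u] spends strictly on its members contained in [A]; members that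
    merely meet [A] are not counted. *)
Definition cost (A : set 'rV[R]_d) : \bar R :=
  (\sum_(0 <= p <oo) (if `[< Q p `<=` A >] then u p else 0))%E.

Lemma cost_term_ge0 A p : (0 <= (if `[< Q p `<=` A >] then u p else 0))%E.
Proof. by case: ifP. Qed.

Lemma cost_ge_term A p : Q p `<=` A -> (u p <= cost A)%E.
Proof.
move=> QA; have := @nneseries_lim_ge R
  (fun p => if `[< Q p `<=` A >] then u p else 0)%E xpredT 0%N p.+1 _.
move=> /(_ (fun n _ _ => cost_term_ge0 A n)); apply: le_trans.
rewrite big_nat_recr//= asboolT// leeDr//; apply: sume_ge0 => i _.
exact: cost_term_ge0.
Qed.

(** Superadditivity: a nonempty member of the cover is contained in at most one of the disjoint
    sets, so no price is counted twice. *)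
Lemma cost_disjoint_sum (T : eqType) (Y : seq T) (C : T -> set 'rV[R]_d) A :
  uniq Y -> (forall y, y \in Y -> C y `<=` A) ->
  (forall y z x, y \in Y -> z \in Y -> C y x -> C z x -> y = z) ->
  (\sum_(y <- Y) cost (C y) <= cost A)%E.
Proof.
move=> uY CA dC; rewrite /cost -nneseries_sum; last by move=> *; exact: cost_term_ge0.
apply: lee_nneseries => [p _ _|p _].
  by apply: sume_ge0 => y _; exact: cost_term_ge0.
(* An empty member is contained in every [C y]; it is harmless because its price is 0. *)
have [/u0 up0|/set0P[x Qx]] := eqVneq (Q p) set0.
  by rewrite big1 ?cost_term_ge0// => y _; rewrite up0 if_same.
have [hy|hy] := boolP (has (fun y => `[< Q p `<=` C y >]) Y); last first.
  rewrite big_seq big1 ?cost_term_ge0// => y yY.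
  by have /negbTE -> := hasPn hy _ yY.
have [y yY /asboolP Qy] := hasP hy.
rewrite (bigD1_seq y)//= asboolT// [X in (_ + X)%E]big_seq_cond big1 ?adde0.
  by rewrite asboolT//; apply: subset_trans Qy (CA _ yY).
move=> z /andP[zY zy]; case: asboolP => // Qz.
by rewrite (dC z y x zY yY (Qz _ Qx) (Qy _ Qx)) eqxx in zy.
Qed.

End Costs.

Section Descent.
Context {R : realType} {d : nat}.
Variables (b : nat) (g : R -> R) (L : nat).
Hypothesis b1 : (1 < b)%N.
Hypothesis g_gt0 : forall n, (L <= n)%N -> 0 < g (b%:R ^- n).
Implicit Types (n l : nat) (k : 'rV[int]_d) (x : 'rV[R]_d) (O : set 'rV[R]_d).

Let b0 : (0 < b)%N := ltnW b1.
Local Notation cube := (@cube R d).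

Definition side n : R := b%:R ^- n.
Definition cube_at l x : set 'rV[R]_d := cube b l (cubeidx b l x).

(* A finite mass distribution [(x, l, w)], each atom of mass [w] being carried
   by the cube of generation [l] around [x]. *)
Definition mass_family O n k (Z : seq ('rV[R]_d * nat * R)) :=
  [/\ 1 <= \sum_(z <- Z) z.2,
      forall z, z \in Z -> 0 <= z.2,
      forall z, z \in Z -> (n < z.1.2)%N /\
        [set y | `|y - z.1.1| <= side z.1.2] `<=` cube b n k `&` O &
      forall n' k', (n <= n')%N -> cube b n' k' `<=` cube b n k ->
        (exists2 z, z \in Z & cube_at z.1.2 z.1.1 `<=` cube b n' k') ->
        \sum_(z <- Z | `[< cube_at z.1.2 z.1.1 `<=` cube b n' k' >]) z.2 <=
          g (side n') / g (side n)].

Definition mass_property O n k := exists Z, mass_family O n k Z.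

Variable Q : nat -> set 'rV[R]_d.
Hypothesis Q_cube :
  forall p, Q p = set0 \/ exists n k, (L <= n)%N /\ Q p = cube b n k.
Variable u : nat -> \bar R.
Hypothesis u_ge0 : forall p, (0 <= u p)%E.
Hypothesis u0 : forall p, Q p = set0 -> u p = 0%E.
Hypothesis u_cube : forall p n k, Q p = cube b n k -> u p = (g (side n))%:E.

Local Notation S := (cost Q u).

(** In a good cube, replacing the cover members inside it by the cube itself does not raise the
    cost. Nonempty members of the cover are good. The defect propagated by the descent is the
    absence of any good cube around the current one. *)
Definition good n k := (L <= n)%N /\ ((g (side n))%:E <= S (cube b n k))%E.
Definition maximal_good n k := good n k /\
  forall n' k', good n' k' -> cube b n k `<=` (cube b n' k') ->
  (n <= n')%N.
Definition covered (A : set 'rV[R]_d) := exists n k, good n k /\ A `<=` cube b n k.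

Lemma covered_maximal (A : set 'rV[R]_d) : A !=set0 -> covered A ->
  exists nk : nat * 'rV[int]_d, maximal_good nk.1 nk.2 /\ A `<=` cube b nk.1 nk.2.
Proof.
move=> [x Ax] [n [k [gnk Ak]]].
have ex : exists n, `[< exists k, good n k /\ A `<=` cube b n k >].
  by exists n; apply/asboolP; exists k.
case: (ex_minnP ex) => m /asboolP[k' [gk' Ak']] mmin.
exists (m, k'); split => //=; split => // n' k'' g' sub.
by apply: mmin; apply/asboolP; exists k''; split => //; apply: subset_trans sub.
Qed.

Lemma maximal_good_disjoint (y z : nat * 'rV[int]_d) x :
  maximal_good y.1 y.2 -> maximal_good z.1 z.2 ->
  cube b y.1 y.2 x -> cube b z.1 z.2 x -> y = z.
Proof.
case: y z => [n1 k1] [n2 k2] /= [g1 m1] [g2 m2] h1 h2.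
have n12 : n1 = n2.
  apply/eqP; rewrite eqn_leq; apply/andP; split; rewrite leqNgt; apply/negP => lt.
    by have := m1 _ _ g2 (cube_nested b0 (ltnW lt) h2 h1); rewrite leqNgt lt.
  by have := m2 _ _ g1 (cube_nested b0 (ltnW lt) h1 h2); rewrite leqNgt lt.
by subst n2; rewrite (cube_inj b0 h1 h2).
Qed.

Lemma good_of_cover p : Q p !=set0 -> forall n k, (L <= n)%N -> Q p = cube b n k ->
  good n k.
Proof.
by move=> _ n k Ln E; split=> //; rewrite -(u_cube E); apply: cost_ge_term => //; rewrite E.
Qed.

(** Suppose every atom's cube lies in a good cube, and take maximal ones. They are disjoint, so
    their costs add up to at most the cost of the big cube; each cost is at least [g] of the side,
    hence at least g(side n) times the mass it holds. As the total mass is at least 1, the big cube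
    would be good. A factor other than 1 in the mass bound would break this conclusion. *)
Lemma uncovered_descent O n k : (L <= n)%N -> mass_property O n k ->
  ~ covered (cube b n k) ->
  exists l x, [/\ (n < l)%N,
    [set y | `|y - x| <= side l] `<=` cube b n k `&` O & ~ covered (cube_at l x)].
Proof.
move=> Ln [Z [Z1 Z0 ZO Zg]] ncov; apply: contrapT => hall.
have cov z : z \in Z -> covered (cube_at z.1.2 z.1.1).
  move=> zZ; apply: contrapT => nc; apply: hall.
  by exists z.1.2, z.1.1; split => //; have [] := ZO _ zZ.
have ch z : exists nk : nat * 'rV[int]_d, z \in Z ->
    maximal_good nk.1 nk.2 /\ cube_at z.1.2 z.1.1 `<=` cube b nk.1 nk.2.
  have [zZ|zZ] := boolP (z \in Z); last by exists (0%N, 0).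
  have [|nk h] := covered_maximal _ (cov _ zZ); last by exists nk.
  by exists z.1.1; exact: cube_self.
have {ch} [f fP] := choice ch.
have fx z : z \in Z -> cube b (f z).1 (f z).2 z.1.1.
  by move=> zZ; apply: (fP _ zZ).2; exact: cube_self.
have zx z : z \in Z -> cube b n k z.1.1.
  move=> zZ; have [_ /(_ z.1.1)[]//] := ZO _ zZ.
  by rewrite /= subrr normr0 /side ltW// side_gt0.
(* A good cube of generation at most n that meets [cube b n k] would contain it. *)
have nf z : z \in Z -> (n < (f z).1)%N.
  move=> zZ; rewrite ltnNge; apply/negP => le; apply: ncov.
  exists (f z).1, (f z).2; split; first by have [[]] := fP _ zZ.
  exact: cube_nested le (fx _ zZ) (zx _ zZ).
have fsub z : z \in Z -> cube b (f z).1 (f z).2 `<=` (cube b n k).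
  by move=> zZ; apply: cube_nested (ltnW (nf _ zZ)) (zx _ zZ) (fx _ zZ).
pose Y := undup (map f Z).
have YP y : y \in Y -> exists2 z, z \in Z & y = f z.
  by rewrite mem_undup => /mapP.
have gn0 := g_gt0 Ln.
apply: ncov; exists n, k; split => //; split => //.
have SY : (\sum_(y <- Y) S (cube b y.1 y.2) <= S (cube b n k))%E.
  apply: cost_disjoint_sum => //; first exact: undup_uniq.
    by move=> y /YP[z zZ ->]; exact: fsub.
  move=> y z x /YP[y' y'Z ->] /YP[z' z'Z ->].
  by apply: maximal_good_disjoint; [have [] := fP _ y'Z|have [] := fP _ z'Z].
apply: le_trans SY; apply: (@le_trans _ _ (\sum_(y <- Y) (g (side y.1))%:E)%E).
  rewrite sumEFin lee_fin.
  apply: (@le_trans _ _ (g (side n) * \sum_(z <- Z) z.2)); first by rewrite ler_peMr// ltW.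
  apply: (@le_trans _ _ (g (side n) * \sum_(y <- Y)
      \sum_(z <- Z | `[< cube_at z.1.2 z.1.1 `<=` cube b y.1 y.2 >]) z.2)).
    rewrite ler_pM2l//.
    under [leRHS]eq_bigr do rewrite big_mkcond.
    rewrite exchange_big/= big_seq [leRHS]big_seq; apply: ler_sum => z zZ.
    rewrite (bigD1_seq (f z)) ?undup_uniq//=; last by rewrite mem_undup map_f.
    rewrite asboolT; last by have [] := fP _ zZ.
    rewrite lerDl; apply: sumr_ge0 => y _; case: ifP => // _; exact: Z0.
  rewrite mulr_sumr big_seq [leRHS]big_seq; apply: ler_sum => y /YP[z zZ ->].
  rewrite -ler_pdivlMl// mulrC; apply: Zg => //.
  - exact/ltnW/nf.
  - exact: fsub.
  - by exists z => //; have [] := fP _ zZ.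
rewrite big_seq [leRHS]big_seq; apply: lee_sum => y /YP[z zZ ->].
by have [[[_ ?] _] _] := fP _ zZ.
Qed.

Lemma cube_at_sub l x : cube_at l x `<=` [set y | `|y - x| <= side l].
Proof. by move=> y hy /=; apply/ltW/(cube_dist b0 hy)/cube_self. Qed.

(** If the cube were uncovered, iterating the descent with [O 0], [O 1], ... would give nested
    closed balls whose common point lies in every [O N]. That point belongs to a cover member, which
    is good and contains a late uncovered cube: a contradiction. *)
Lemma limsup_covered (O : nat -> set 'rV[R]_d) n0 k0 : (L <= n0)%N ->
  (forall N n k, (L <= n)%N -> cube b n k `<=` (cube b n0 k0) ->
     mass_property (O N) n k) ->
  (\bigcap_N O N) `&` cube b n0 k0 `<=` \bigcup_p Q p ->
  covered (cube b n0 k0).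
Proof.
move=> Ln0 MP FQ; apply: contrapT => nc0.
pose st := (nat * nat * 'rV[R]_d)%type.
(* A state is (step, generation, point); keeping the generation at least the step number makes the
   cubes shrink. *)
pose ok (t : st) := [/\ (L <= t.1.2)%N, (t.1.1 <= t.1.2)%N,
  cube_at t.1.2 t.2 `<=` (cube b n0 k0) & ~ covered (cube_at t.1.2 t.2)].
pose T := {t : st | ok t}.
pose next (s t : T) := [/\ (sval s).1.1.+1 = (sval t).1.1 &
  [set y | `|y - (sval t).2| <= side (sval t).1.2] `<=`
    cube_at (sval s).1.2 (sval s).2 `&` O (sval s).1.1].
have [x0 x0in] := @cube_nonempty R _ b n0 k0 b0.
have at0 : cube_at n0 x0 = cube b n0 k0 by rewrite /cube_at -(cubeP n0 k0 x0 b0).1.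
have ok0 : ok (0%N, n0, x0) by split; rewrite //= at0.
have nextP (s : T) : {t : T | next s t}.
  apply: cid; case: s => -[[N n] x] [/= Ln Nn sub nc].
  have [l [y [nl hsub hnc]]] := uncovered_descent Ln (MP N _ _ Ln sub) nc.
  have okt : ok (N.+1, l, y).
    split => //=; [exact: leq_trans Ln (ltnW nl)|exact: leq_trans nl|].
    by apply: subset_trans sub => z /cube_at_sub /hsub[].
  by exists (exist _ _ okt).
have [f [f0 fS]] := dependent_choice nextP (exist _ _ ok0).
pose x n := (sval (f n)).2; pose l n := (sval (f n)).1.2.
have N1 n : (sval (f n)).1.1 = n.
  elim: n => [|n ih]; first by rewrite f0.
  by have [<- _] := fS n; rewrite ih.
have stp n : [set y | `|y - x n.+1| <= side (l n.+1)] `<=` cube_at (l n) (x n) `&` O n.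
  by have [_] := fS n; rewrite N1.
have [y hy] := @nested_balls R d x (fun n => side (l n)) (fun n => ltW (side_gt0 _ b0))
  (fun n => subset_trans (stp n) (subset_trans (@subIsetl _ _ _) (@cube_at_sub _ _))).
have yin n : (cube_at (l n) (x n) `&` O n) y by apply: stp; exact: hy.
have okn n : ok (sval (f n)) := svalP (f n).
have [|p _ Qy] := FQ y.
  split; first by move=> n _; have [] := yin n.
  by have [_ _ sub _] := okn 0%N; apply: sub; have [] := yin 0%N.
have [Q0|[n [k [Ln E]]]] := Q_cube p; first by rewrite Q0 in Qy.
(* For a cover member of generation n, step n is late enough: the cube reached there has generation
   at least n and shares [y] with the member, hence lies inside it. *)
have [_ ln _ nc] := okn n; apply: nc; exists n, k; split.
  by apply: good_of_cover Ln E; exists y.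
rewrite N1 in ln; rewrite E in Qy; apply: cube_nested ln Qy _ => //.
by have [] := yin n.
Qed.

End Descent.

(** * Net premeasures *)

Section GaugeRange.
Context {R : realType} {d : nat}.
Variable g : R -> R.
Hypothesis gg : gauge d g.
Local Notation eps := (eps_gauge d g).

Lemma gauge_upto_le e e' : e' <= e -> gauge_upto d g e -> gauge_upto d g e'.
Proof.
move=> ee [[gc gm] gp gd]; split.
- split; first by apply: continuous_subspaceW gc; exact: subset_itvl.
  by move=> r s; rewrite !in_itv/= => /andP[r0 re] /andP[s0 se]; apply: gm; rewrite in_itv/= ?r0 ?s0
    ?(le_trans re) ?(le_trans se).
- by move=> r; rewrite in_itv/= => /andP[r0 re]; apply: gp; rewrite in_itv/= r0 (le_trans re).
- move=> r s; rewrite !in_itv/= => /andP[r0 re] /andP[s0 se].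
  by apply: gd; rewrite in_itv/= ?r0 ?s0 ?(le_trans re) ?(le_trans se).
Qed.

Lemma eps_gauge_has_sup : has_sup [set e | 0 < e <= 1 /\ gauge_upto d g e].
Proof.
have [_ [e e0 ge]] := gg; split.
  exists (Num.min e 1); split; first by rewrite lt_min e0 ltr01 ge_min lexx orbT.
  by apply: gauge_upto_le ge; rewrite ge_min lexx.
by exists 1 => x [/andP[]].
Qed.

Lemma eps_gauge_gt0 : 0 < eps.
Proof.
have [[e [/andP[e_gt0 e1] ge]] ub] := eps_gauge_has_sup.
by apply: (lt_le_trans e_gt0); apply: sup_ubound => //=; rewrite e_gt0.
Qed.

Lemma eps_gauge_le1 : eps <= 1.
Proof.
have [ne _] := eps_gauge_has_sup.
by apply: ge_sup => // x [/andP[]].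
Qed.

(** [eps_gauge] is a supremum that need not be attained, so regularity of [g] is only available
    strictly below it. *)
Lemma eps_gauge_upto r : r < eps -> exists2 e, r <= e & gauge_upto d g e.
Proof.
have [ne _] := eps_gauge_has_sup.
by move=> /(sup_gt ne)[e [_ ge] re]; exists e => //; exact: ltW.
Qed.

Lemma gauge_gt0 r : 0 < r -> r < eps -> 0 < g r.
Proof.
move=> r0 /eps_gauge_upto[e re [_ gp _]].
have := gp r; rewrite in_itv/= r0 re => /(_ isT).
by rewrite pmulr_lgt0 ?invr_gt0 ?exprn_gt0.
Qed.

Lemma gauge_le r s : 0 <= r -> r <= s -> s < eps -> g r <= g s.
Proof.
move=> r0 rs /eps_gauge_upto[e se [[_ gm] _ _]].
by apply: gm => //; rewrite in_itv/= ?r0 ?se ?(le_trans rs) ?(le_trans r0).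
Qed.

Lemma gauge_ratio_le r s : 0 < r -> r <= s -> s < eps ->
  g s / s ^+ d <= g r / r ^+ d.
Proof.
move=> r0 rs /eps_gauge_upto[e se [_ _ gd]].
by apply: gd => //; rewrite in_itv/= ?r0 ?se ?(le_trans rs) ?(lt_le_trans r0).
Qed.

End GaugeRange.

Section NetPremeasure.
Context {R : realType} {d : nat}.
Variables (b : nat) (g : R -> R).
Hypothesis d0 : (0 < d)%N.
Hypothesis b1 : (1 < b)%N.
Hypothesis gg : gauge d g.
Implicit Types (F U V : set 'rV[R]_d) (Q : nat -> set 'rV[R]_d).

Let b0 : (0 < b)%N := ltnW b1.
Local Notation cube := (@cube R d).
Local Notation eps := (eps_gauge d g).

Lemma net_generation : exists L, forall n, ((b%:R : R) ^- n < eps) = (L <= n)%N.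
Proof.
have ex := side_small b1 (eps_gauge_gt0 gg).
case: (ex_minnP ex) => L hL Lmin; exists L => n.
apply/idP/idP; first exact: Lmin.
by move=> Ln; apply: le_lt_trans hL; exact: side_le.
Qed.

Lemma cadic_neg_diam m k : (diam (cadic b (Negz m) k : set 'rV[R]_d) < 1) = false.
Proof.
apply/negbTE; rewrite -leNgt.
pose pt (s : R) : 'rV[R]_d := (b%:R : R) ^ (- Negz m) *: (zvec k + const_mx s).
have ptin s : 0 <= s < 1 -> cadic b (Negz m) k (pt s).
  by move=> hs; exists (const_mx s) => // i; rewrite mxE.
have E s : `|pt s - pt 0| = `|(b%:R : R) ^+ m.+1 * s|.
  rewrite /pt -scalerBr opprD addrACA subrr add0r normrZ normrM; congr (_ * _).
  apply/eqP; rewrite eq_le; apply/andP; split.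
    by apply/norm_leP => // i; rewrite !mxE subr0.
  by have := coord_le_norm (const_mx s - const_mx 0 : 'rV[R]_d) (Ordinal d0);
    rewrite !mxE subr0.
have B1 : 1 < (b%:R : R) ^+ m.+1 by rewrite exprn_egt1// ltr1n.
have B0 := lt_trans ltr01 B1.
(* The cube has side b^(m+1), so this choice of [s] puts two of its points at distance exactly 1. *)
set s := (b%:R : R) ^- m.+1.
have hs : 0 <= s < 1 by rewrite invr_ge0 ltW//= invf_lt1.
have <- : `|pt s - pt 0| = 1 by rewrite E mulfV ?normr1// gt_eqF.
apply: sup_ubound; last first.
  by exists (pt s, pt 0) => //; split; apply: ptin; rewrite ?lexx ?ltr01.
exists ((b%:R : R) ^+ m.+1) => _ [[x y] [/= [x' hx <-] [y' hy <-]] <-].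
rewrite -scalerBr opprD addrACA subrr add0r normrZ ger0_norm ?exprn_ge0//.
rewrite ler_piMr ?(ltW B0)//; apply/norm_leP => // i; rewrite !mxE ler_norml.
by have /andP[? ?] := hx i; have /andP[? ?] := hy i; apply/andP; split; lra.
Qed.

Lemma cadic_small_cube L (A : set 'rV[R]_d) :
  (forall n, ((b%:R : R) ^- n < eps) = (L <= n)%N) ->
  cadic_or_empty b A -> diam A < eps ->
  A = set0 \/ exists n k, (L <= n)%N /\ A = cube b n k.
Proof.
move=> hL [->|[j [k ->]]] dA; first by left.
right; case: j dA => [n|m] dA.
  by exists n, k; split => //; rewrite -hL -(diam_cube n k d0 b0).
have := lt_le_trans dA (eps_gauge_le1 gg).
by rewrite cadic_neg_diam.
Qed.

Lemma diam_set0 : diam (set0 : set 'rV[R]_d) = 0.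
Proof.
rewrite /diam (_ : [set _ | _ in _] = set0) ?sup0//.
by apply/seteqP; split => // x [[y z] [[]]].
Qed.

Local Notation S Q := (cost Q (fun p => (g (diam (Q p)))%:E)).

(** A cover of F /\ U is turned into a cover of U that costs no more: take all maximal good cubes.
    They cover U because every small cube inside U lies in a good one, and they are disjoint, so
    their total price is bounded by the total cost. *)
Lemma net_premeasure_restrict L F U :
  (forall n, ((b%:R : R) ^- n < eps) = (L <= n)%N) -> open U ->
  (forall Q, (forall p, Q p = set0 \/ exists n k, (L <= n)%N /\ Q p = cube b n k) ->
     F `&` U `<=` \bigcup_p Q p ->
     forall n k, (L <= n)%N -> cube b n k `<=` U ->
     covered b g L Q (fun p => (g (diam (Q p)))%:E) (cube b n k)) ->
  net_premeasure b g (F `&` U) = net_premeasure b g U.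
Proof.
move=> hL oU hcov; have [g0 _] := gg.
have sn n : (L <= n)%N -> (b%:R : R) ^- n < eps by rewrite hL.
have gn0 n : (L <= n)%N -> 0 < g (b%:R ^- n).
  by move=> /sn; apply: gauge_gt0 => //; exact: side_gt0.
apply/eqP; rewrite eq_le; apply/andP; split.
  apply: ereal_inf_le_tmp => _ [Q [Q1 Q2 Q3] <-]; exists Q => //; split => //.
  by apply: subset_trans Q2; exact: subIsetr.
apply: le_ereal_inf_tmp => _ [Q [Qc QF Qd] <-].
have Qcube p := cadic_small_cube hL (Qc p) (Qd p).
pose u p := (g (diam (Q p)))%:E.
have u_ge0 p : (0 <= u p)%E.
  rewrite /u lee_fin; have [->|[n [k [Ln ->]]]] := Qcube p; first by rewrite diam_set0 g0.
  by rewrite diam_cube// ltW// gn0.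
have u0 p : Q p = set0 -> u p = 0%E by rewrite /u => ->; rewrite diam_set0 g0.
pose mg (y : nat * 'rV[int]_d) := `[< maximal_good b g L Q u y.1 y.2 >].
(* The maximal good cubes are listed by their [pickle] codes; every other code yields the empty set,
   of price g 0 = 0. *)
pose lam p : set 'rV[R]_d := if pickle_inv p is Some y then
  if mg y then cube b y.1 y.2 else set0 else set0.
have lamE p : lam p = set0 \/ exists n k, (L <= n)%N /\ lam p = cube b n k.
  rewrite /lam; case: pickle_inv => [y|]; last by left.
  have [/asboolP[[]]|] := boolP (mg y); last by left.
  by right; exists y.1, y.2.
apply: (@le_trans _ _ (\sum_(0 <= p <oo) (g (diam (lam p)))%:E)%E).
  apply: ereal_inf_lbound; exists lam => //; split.
  - move=> p; have [->|[n [k [_ ->]]]] := lamE p; first by left.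
    by right; exists n%:Z, k.
  - move=> x Ux.
    have [e /= e0 eU] : exists2 e : R, 0 < e & ball x e `<=` U.
      by move: oU; rewrite openE => /(_ _ Ux) /nbhs_ballP[e e0 eU]; exists e.
    have [m hm] := side_small b1 e0.
    pose n := maxn L m.
    have sub : cube_at b n x `<=` U.
      apply: subset_trans eU => y /(cube_dist b0 (cube_self _ _ b0)) h.
      rewrite -ball_normE /=; apply: lt_trans h _; apply: le_lt_trans hm.
      by apply: side_le => //; exact: leq_maxr.
    have := hcov Q Qcube QF n _ (leq_maxl _ _) sub.
    move=> /covered_maximal [|y [my suby]]; first by exists x; exact: cube_self.
    exists (pickle y) => //; rewrite /lam pickleK_inv.
    by rewrite /mg asboolT//; apply: suby; exact: cube_self.
  - move=> p; have [->|[n [k [Ln ->]]]] := lamE p.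
      by rewrite diam_set0 eps_gauge_gt0.
    by rewrite diam_cube// sn.
apply: (@le_trans _ _ (cost Q u setT)); last first.
  apply: lee_nneseries => p _; first by move=> _; exact: cost_term_ge0.
  by case: ifP => // _; exact: u_ge0.
have lam_ge0 p : (0 <= (g (diam (lam p)))%:E)%E.
  rewrite lee_fin; have [->|[n [k [Ln ->]]]] := lamE p; first by rewrite diam_set0 g0.
  by rewrite diam_cube// ltW// gn0.
apply: lime_le; first by apply: is_cvg_nneseries => p _ _; exact: lam_ge0.
apply: nearW => N.
pose Y := [seq y <- pmap pickle_inv (iota 0 N) | mg y].
have YP y : y \in Y -> maximal_good b g L Q u y.1 y.2.
  by rewrite mem_filter => /andP[/asboolP].
apply: (@le_trans _ _ (\sum_(y <- Y) cost Q u (cube b y.1 y.2))%E); last first.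
  apply: cost_disjoint_sum => //.
    by rewrite filter_uniq// (pmap_uniq (@pickle_invK _))// iota_uniq.
  by move=> y z x /YP my /YP mz; exact: maximal_good_disjoint my mz.
rewrite big_filter [leRHS]big_mkcond big_pmap /index_iota subn0.
apply: lee_sum => p _; rewrite /lam; case: pickle_inv => [y|] /=; last by rewrite diam_set0 g0.
case: ifPn => [/asboolP[[Ly gy] _]|_]; last by rewrite diam_set0 g0.
by rewrite diam_cube.
Qed.

End NetPremeasure.

(** * Gauge functions near zero *)

Section GaugeGerms.
Context {R : realType}.
Implicit Types (phi psi g : R -> R) (r s t beta : R).

Lemma near_right0P (P : R -> Prop) : (\forall r \near (0 : R)^'+, P r) ->
  exists2 e, 0 < e & forall r, 0 < r -> r < e -> P r.
Proof.
rewrite near_withinE => /nbhs_ballP[e e0 h]; exists e => // r r0 re.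
by apply: h => //; rewrite -ball_normE /= sub0r normrN gtr0_norm.
Qed.

Lemma hgaugeE beta phi r : 0 < r -> hgauge beta phi r = r `^ (beta - phi r).
Proof. by move=> r0; rewrite /hgauge gt_eqF. Qed.

Lemma hgauge_gt0 beta phi r : 0 < r -> 0 < hgauge beta phi r.
Proof. by move=> r0; rewrite hgaugeE// powR_gt0. Qed.

Lemma PhiClass_ge0 phi : PhiClass phi ->
  exists2 e, 0 < e & forall r, 0 < r -> r < e -> 0 <= phi r.
Proof.
move=> [[e e0 [_ hm]] p0 _ _]; exists e => // r r0 re; rewrite -p0.
by apply: hm; rewrite ?in_itv/= ?lexx ?(ltW r0) ?(ltW re) ?(ltW e0).
Qed.

Lemma PhiClass_powN_le phi : PhiClass phi -> exists2 e, 0 < e &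
  forall r s, 0 < r -> r <= s -> s < e -> s `^ (- phi s) <= r `^ (- phi r).
Proof.
move=> [_ _ [_ [e e0 h]] _]; exists e => // r s r0 rs se.
by apply: h => //; rewrite in_itv/= ?r0 ?(lt_le_trans r0) ?(ltW se) ?(ltW (le_lt_trans rs se)).
Qed.

(** Monotonicity of h is the case e = beta of the last clause of [PhiClass]. For the quotient,
    h(r)/r^d = r^(beta - d) * r^(-phi r), and both factors are nonincreasing, the first because beta
    <= d. *)
Lemma hgauge_regular (d : nat) beta phi : 0 < beta <= d%:R -> PhiClass phi ->
  exists2 e, 0 < e & forall r s, 0 < r -> r <= s -> s < e ->
    hgauge beta phi r <= hgauge beta phi s /\
    hgauge beta phi s / s ^+ d <= hgauge beta phi r / r ^+ d.
Proof.
move=> /andP[b0 bd] hphi; have [e1 e10 h1] := PhiClass_powN_le hphi.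
have [_ _ _ /(_ _ b0)[_ [e2 e20 h2]]] := hphi.
exists (Num.min e1 e2); first by rewrite lt_min e10.
move=> r s r0 rs; rewrite lt_min => /andP[s1 s2]; have s0 := lt_le_trans r0 rs.
split.
  move: rs; rewrite le_eqVlt => /orP[/eqP->//|rs]; rewrite !hgaugeE// ltW//.
  by apply: h2 => //; rewrite in_itv/= ?r0 ?s0 ?(ltW s2) ?(ltW (lt_trans rs s2)).
have E x : 0 < x -> hgauge beta phi x / x ^+ d = x `^ (beta - d%:R) * x `^ (- phi x).
  move=> x0; rewrite hgaugeE// -powRD ?(gt_eqF x0) ?implybT// addrAC.
  rewrite [in RHS]powRD ?(gt_eqF x0) ?implybT//; congr (_ * _).
  by rewrite powRN powR_mulrn// ltW.
rewrite !E//; apply: ler_pM; rewrite ?powR_ge0//; last exact: h1.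
rewrite -opprB !powRN lef_pV2 ?posrE ?powR_gt0//.
by apply: ge0_ler_powR; rewrite ?nnegrE ?(ltW r0) ?(ltW s0)// subr_ge0.
Qed.

(** With s = r^t, h_{beta/t,phi2}(s) = r^beta * s^(-phi2 s). Since s <= r, and s^(-phi s) is
    nonincreasing in s, this is at least r^beta * r^(-phi r) = h_{beta,phi}(r). So g(r^t) dominates
    h(r), although r^t is much smaller than r. *)
Lemma gauge_prec_large beta phi phi2 t g : 0 < beta -> 1 <= t -> PhiClass phi ->
  (exists2 e, 0 < e & forall r, 0 < r -> r < e -> phi r <= phi2 r) ->
  gauge_prec g (hgauge (beta / t) phi2) -> forall K, exists2 e, 0 < e &
  forall r, 0 < r -> r < e ->
    K * hgauge beta phi r <= g r /\ K * hgauge beta phi r <= g (r `^ t).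
Proof.
move=> b0 t1 hphi [e1 e10 h12] [+ _] K.
have t0 := lt_le_trans ltr01 t1.
move=> /cvgryPge /(_ (Num.max K 0)) /near_right0P[e2 e20 h2].
have [e3 e30 h3] := PhiClass_powN_le hphi.
exists (Num.min (Num.min e1 e2) (Num.min e3 1)); first by rewrite !lt_min e10 e20 e30 ltr01.
move=> r r0; rewrite !lt_min => /andP[/andP[r1 r2] /andP[r3 r4]].
pose h2g := hgauge (beta / t) phi2.
have key x : 0 < x -> x < e2 -> hgauge beta phi r <= h2g x -> K * hgauge beta phi r <= g x.
  (* [Num.max K 0] makes the multiplication monotone when [K] is negative. *)
  move=> x0 xe le; apply: (@le_trans _ _ (Num.max K 0 * h2g x)).
    apply: (@le_trans _ _ (Num.max K 0 * hgauge beta phi r)).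
      by rewrite ler_wpM2r ?(ltW (hgauge_gt0 _ _ _))// le_max lexx.
    by rewrite ler_wpM2l// le_max lexx orbT.
  by rewrite -ler_pdivlMr ?hgauge_gt0//; exact: h2.
have rt0 : 0 < r `^ t by rewrite powR_gt0.
have rtr : r `^ t <= r.
  by rewrite -[leRHS]powRr1 ?(ltW r0)//; apply: ger_powR; rewrite ?r0 ?(ltW r4).
split; apply: key => //.
- rewrite /h2g !hgaugeE//; apply: ger_powR; rewrite ?r0 ?(ltW r4)//.
  rewrite lerB//; last exact: h12.
  by rewrite ler_pdivrMr// ler_peMr// ltW.
- exact: le_lt_trans r2.
- rewrite /h2g !hgaugeE// powRD ?(gt_eqF r0) ?implybT//.
  rewrite powRD ?(gt_eqF rt0) ?implybT//.
  rewrite -[(r `^ t) `^ (beta / t)]powRrM mulrC -[X in _ <= X `^ _ * _]mul1r.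
  rewrite mulrCA mul1r mulfV ?gt_eqF// mulr1 [leRHS]mulrC ler_pM2r ?powR_gt0//.
  apply: (@le_trans _ _ ((r `^ t) `^ (- phi (r `^ t)))); first exact: h3.
  apply: ger_powR; rewrite ?rt0 ?(le_trans rtr (ltW r4))// lerN2.
  by apply: h12 => //; exact: le_lt_trans r1.
Qed.

End GaugeGerms.

(** * Borel sets and finite measures *)

Section BorelSets.
Context {R : realType} {d : nat}.
Implicit Types (A B : set 'rV[R]_d).

Definition bmeasurable A : Prop := measurable (A : set (borel R d)).

Lemma bmeasurableI A B : bmeasurable A -> bmeasurable B -> bmeasurable (A `&` B).
Proof. exact: measurableI. Qed.

Lemma bmeasurableU A B : bmeasurable A -> bmeasurable B -> bmeasurable (A `|` B).
Proof. exact: measurableU. Qed.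

Lemma bmeasurableD A B : bmeasurable A -> bmeasurable B -> bmeasurable (A `\` B).
Proof. exact: measurableD. Qed.

Lemma bmeasurable_open A : open A -> bmeasurable A.
Proof. by move=> oA; apply: sub_sigma_algebra. Qed.

Lemma bmeasurable_closed A : closed A -> bmeasurable A.
Proof.
move=> cA; rewrite /bmeasurable -[A]setCK; apply: measurableC.
by apply: bmeasurable_open; rewrite openC.
Qed.

Lemma bmeasurable_preimage (f : 'rV[R]_d -> 'rV[R]_d) A :
  continuous f -> bmeasurable A -> bmeasurable (f @^-1` A).
Proof.
move=> cf; apply: (@smallest_sub _ _ _ [set B | bmeasurable (f @^-1` B)]).
- split => [|B|F] /=.
  + rewrite preimage_set0; exact: measurable0.
  + by move=> mB; rewrite setTD preimage_setC; exact: measurableC.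
  + by move=> mF; rewrite preimage_bigcup; exact: bigcupT_measurable.
- by move=> B oB; apply: bmeasurable_open; apply: open_comp => // x _; exact: cf.
Qed.

Lemma bmeasurable_cube b n k : (0 < b)%N -> bmeasurable (cube b n k).
Proof.
move=> b0.
have cf i : continuous (fun x : 'rV[R]_d => b%:R ^+ n * x ord0 i : R).
  move=> x; have h : (fun y : 'rV[R]_d => y ord0 i : R) y @[y --> x] --> x ord0 i.
    exact: coord_continuous.
  exact: (cvgMl_tmp h).
have -> : cube b n k = \bigcap_(i in [set: 'I_d])
    ((fun x : 'rV[R]_d => b%:R ^+ n * x ord0 i) @^-1` [set u | (k ord0 i)%:~R <= u] `&`
     (fun x : 'rV[R]_d => b%:R ^+ n * x ord0 i) @^-1` [set u | u < (k ord0 i)%:~R + 1]).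
  apply/seteqP; split=> x.
    by move=> /(cubeE _ _ _ b0) h i _ /=; have /andP[] := h i.
  by move=> h; apply/cubeE => // i; have [/= -> ->] := h i I.
apply: fin_bigcap_measurable => // i _; apply: measurableI.
  apply: bmeasurable_closed; apply: preimage_closed; last exact: closed_ge.
  by move=> x _; exact: cf.
apply: bmeasurable_open; apply: open_comp; last exact: open_lt.
by move=> x _; exact: cf.
Qed.

Lemma bmeasurable_hcube : bmeasurable hcube.
Proof. by rewrite (@hcubeE _ _ 1)//; exact: bmeasurable_cube. Qed.

Lemma bmeasurable_ball (z : 'rV[R]_d) r : bmeasurable [set y | `|y - z| <= r].
Proof.
apply: bmeasurable_closed.
rewrite (_ : mkset _ = (fun y : 'rV[R]_d => `|y - z|) @^-1` [set u | u <= r])//.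
apply: preimage_closed; last exact: closed_le.
move=> x _; apply: continuous_comp; last exact: norm_continuous.
exact: (cvgB cvg_id (cvg_cst z)).
Qed.

Lemma bmeasurable_shift (v : 'rV[R]_d) A :
  bmeasurable A -> bmeasurable ((fun y => y + v) @^-1` A).
Proof.
apply: bmeasurable_preimage => x; exact: (cvgD cvg_id (cvg_cst v)).
Qed.

Lemma open_ocube : open (ocube : set 'rV[R]_d).
Proof.
have cf i : continuous (fun x : 'rV[R]_d => x ord0 i) by exact: coord_continuous.
have -> : ocube = \bigcap_(i in [set` index_enum 'I_d])
    ((fun x : 'rV[R]_d => x ord0 i) @^-1` [set u | 0 < u] `&`
     (fun x : 'rV[R]_d => x ord0 i) @^-1` [set u | u < 1]).
  apply/seteqP; split=> x h.
    by move=> i _ /=; have /andP[] := h i.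
  by move=> i; have [|/= -> ->//] := h i; rewrite /= mem_index_enum.
rewrite bigcap_seq; apply: big_ind => [|A B|i _]; first exact: openT.
  exact: openI.
apply: openI; apply: open_comp => [x _|]; try exact: cf.
  exact: open_gt.
exact: open_lt.
Qed.

End BorelSets.

Section FiniteMeasure.
Context {R : realType} {d : nat}.
Variable m : {finite_measure set (borel R d) -> \bar R}.
Implicit Types (A B : set 'rV[R]_d).

Lemma bmeasure_le A B : bmeasurable A -> bmeasurable B -> A `<=` B -> (m A <= m B)%E.
Proof. by move=> mA mB AB; apply: (@le_measure _ _ _ m); rewrite ?inE. Qed.

Lemma bmeasure_fin_num A : bmeasurable A -> m A \is a fin_num.
Proof. by move=> mA; exact: fin_num_measure. Qed.

Lemma measure_seq_cover (T : eqType) (s : seq T) (F : T -> set 'rV[R]_d) A :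
  (forall i, bmeasurable (F i)) -> bmeasurable A ->
  (forall x, A x -> exists2 i, i \in s & F i x) ->
  (m A <= \sum_(i <- s) m (F i))%E.
Proof.
move=> mF mA cov; pose U := \big[setU/set0]_(i <- s) F i.
have mU s' : bmeasurable (\big[setU/set0]_(i <- s') F i).
  elim: s' => [|i s' ih]; first by rewrite big_nil; exact: measurable0.
  by rewrite big_cons; exact: measurableU (mF i) ih.
have UA : A `<=` U.
  move=> x /cov[i]; rewrite /U; elim: (s) => [//|j s' ih].
  rewrite inE big_cons => /orP[/eqP->|/ih h] Fx; [by left|by right; exact: h].
apply: (le_trans (bmeasure_le mA (mU s) UA)); rewrite /U; elim: (s) => [|i s' ih].
  by rewrite !big_nil measure0.
rewrite !big_cons; apply: (@le_trans _ _ (m (F i) + m (\big[setU/set0]_(j <- s') F j))%E).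
  by apply: measureU2; [exact: mF|exact: mU].
exact: leeD2l.
Qed.

(** Offsets from -N to N are shifted by N so as to range over a finite type; a ball is then covered
    by a finite sum of (2N+1)^d cubes. *)
Definition near_cube b n N (z : 'rV[R]_d) (u : 'rV['I_(2 * N).+1]_d) : set 'rV[R]_d :=
  cube b n (\row_i (cubeidx b n z ord0 i + (u ord0 i : nat)%:Z - N%:Z)).

Lemma ball_cube_cover b n N (z y : 'rV[R]_d) : (0 < b)%N ->
  `|y - z| <= N%:R * b%:R ^- n ->
  exists u, @near_cube b n N z u y.
Proof.
move=> b0 h; have B0 : 0 < (b%:R : R) ^+ n by rewrite exprn_gt0 // ltr0n.
have [|hi _] := @norm_leP R d (y - z) (N%:R * b%:R ^- n).
  by rewrite mulr_ge0// ltW// side_gt0.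
have {hi} := hi h => {}h.
have hb i : - N%:Z <= cubeidx b n y ord0 i - cubeidx b n z ord0 i <= N%:Z.
  rewrite !cubeidxE; have := h i; rewrite !mxE -(ler_pM2l B0) mulrCA mulfV ?gt_eqF// mulr1.
  rewrite -{1}(gtr0_norm B0) -normrM mulrBr ler_norml => /andP[h1 h2].
  have /andP[ly uy] := floor_itv (b%:R ^+ n * y ord0 i).
  have /andP[lz uz] := floor_itv (b%:R ^+ n * z ord0 i).
  rewrite !intrD1 in uy uz.
  set a := Num.floor _ in ly uy *; set e := Num.floor _ in lz uz *.
  have h3 : a < e + 1 + N%:Z.
    by rewrite -(ltr_int R) !rmorphD/= -[1%:~R]/(1 : R) -[(N : int)%:~R]/(N%:R : R); lra.
  have h4 : e < a + 1 + N%:Z.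
    by rewrite -(ltr_int R) !rmorphD/= -[1%:~R]/(1 : R) -[(N : int)%:~R]/(N%:R : R); lra.
  by move: (a) (e) h3 h4 => ? ? ? ?; lia.
exists (\row_i inord (absz (cubeidx b n y ord0 i - cubeidx b n z ord0 i + N%:Z))).
apply/cubeP => //; apply/rowP => i; rewrite !mxE.
by have := hb i; rewrite !mxE => ?; rewrite inordK; lia.
Qed.

Lemma measure_ball_le b n N (z : 'rV[R]_d) A (B : R) : (0 < b)%N -> bmeasurable A ->
  (forall u, (m (A `&` @near_cube b n N z u) <= B%:E)%E) ->
  (m (A `&` [set y | `|y - z| <= N%:R * b%:R ^- n]%R) <=
    (((2 * N).+1 ^ d)%N%:R * B)%:E)%E.
Proof.
move=> b0 mA hB.
pose F u := A `&` @near_cube b n N z u.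
apply: (@le_trans _ _ (\sum_(u <- index_enum _) m (F u))%E).
  apply: measure_seq_cover.
  - by move=> u; apply: measurableI => //; exact: bmeasurable_cube.
  - by apply: measurableI => //; exact: bmeasurable_ball.
  - by move=> y [Ay /(ball_cube_cover b0)[u hu]]; exists u => //; exact: mem_index_enum.
apply: (@le_trans _ _ (\sum_(u : 'rV['I_(2 * N).+1]_d) B%:E)%E).
  by apply: lee_sum => u _; exact: hB.
by rewrite sumEFin lee_fin sumr_const card_mx card_ord mul1n mulr_natl.
Qed.

End FiniteMeasure.

(** * Consequences of the ubiquity hypotheses *)

Section CadicNeighbours.
Context {R : realType} {d : nat}.
Implicit Types (x y z : 'rV[R]_d) (k p : 'rV[int]_d).

Lemma zvecD k p : zvec (k + p) = zvec k + zvec p :> 'rV[R]_d.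
Proof. by apply/rowP => i; rewrite !mxE rmorphD. Qed.

Lemma zvecN k : zvec (- k) = - zvec k :> 'rV[R]_d.
Proof. by apply/rowP => i; rewrite !mxE rmorphN. Qed.

Lemma cube_translate c n k p x : (0 < c)%N ->
  cube c n (k + p) (x + (c%:R : R) ^- n *: zvec p) <-> cube c n k x.
Proof.
move=> c0; have B0 : (c%:R : R) ^+ n != 0 by rewrite expf_neq0// pnatr_eq0 -lt0n.
by rewrite !cubeE//; split=> h i; have := h i;
  rewrite !mxE mulrDr mulrA mulfV// mul1r rmorphD/= addrAC lerD2r ltrD2r.
Qed.

Lemma cube_range c n k x : (0 < c)%N -> cube c n k x -> hcube x ->
  forall i, 0 <= k ord0 i /\ (k ord0 i)%:~R <= (c%:R : R) ^ n%:Z - 1.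
Proof.
move=> c0 /(cubeE _ _ _ c0) hk hx i; have B0 : 0 < (c%:R : R) ^+ n by rewrite exprn_gt0 // ltr0n.
have /andP[h1 h2] := hk i; have /andP[x0 x1] := hx i.
split.
  have : (-1)%:~R < (k ord0 i)%:~R :> R.
    rewrite rmorphN /= -subr_gt0 opprK; apply: le_lt_trans h2.
    by rewrite mulr_ge0// ltW.
  rewrite ltr_int; move: (k _ _) => ?; lia.
have : (k ord0 i)%:~R < ((c ^ n)%N%:Z)%:~R :> R.
  by apply: le_lt_trans h1 _; rewrite -pmulrn natrX gtr_pMr.
rewrite ltr_int => h; rewrite lerBrDr -[1]/(1%:~R) -rmorphD/=.
apply: (@le_trans _ _ (((c ^ n)%N%:Z)%:~R : R)); last by rewrite -pmulrn natrX.
rewrite ler_int; move: (k _ _) h => ? ?; lia.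
Qed.

Lemma cube_sub_cadic3 c n k k0 : (0 < c)%N ->
  (forall i, `|k ord0 i - k0 ord0 i| <= 1) ->
  (cadic c n%:Z k : set 'rV[R]_d) `<=` cadic3 c n%:Z k0.
Proof.
move=> c0 hk y /(cubeE _ _ _ c0) hy.
set ctr := cadic_center c n%:Z k0 : 'rV[R]_d.
have B0 : 0 < (c%:R : R) ^+ n by rewrite exprn_gt0 // ltr0n.
exists (ctr + 3^-1 *: (y - ctr)); last first.
  by rewrite -/ctr addrC [ctr + _]addrC addrK scalerA mulfV ?pnatr_eq0// scale1r subrK.
apply/(cubeE n k0 _ c0) => i.
have Ec : (c%:R : R) ^+ n * ctr ord0 i = (k0 ord0 i)%:~R + 2^-1.
  by rewrite /ctr /cadic_center !mxE -invr_expz mulrA mulfV ?mul1r ?gt_eqF.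
have := hy i; have := hk i.
rewrite ler_norml -!(ler_int R) rmorphB rmorphN/= => /andP[h1 h2] /andP[h3 h4].
have -> (a : 'rV[R]_d) : (a + 3^-1 *: (y - a)) ord0 i =
    a ord0 i + 3^-1 * (y ord0 i - a ord0 i) by rewrite !mxE.
rewrite mulrDr mulrCA mulrBr !Ec.
by rewrite -[1%:~R]/(1 : R) in h1 h2; apply/andP; split; lra.
Qed.

Lemma near_cube_dist c n N z u y : (0 < c)%N -> @near_cube R d c n N z u y ->
  `|y - z| <= N.+1%:R * c%:R ^- n.
Proof.
move=> c0 /(cubeE _ _ _ c0) hy; have /(cubeE _ _ _ c0) hz := cube_self n z c0.
have B0 : 0 < (c%:R : R) ^+ n by rewrite exprn_gt0 // ltr0n.
apply/norm_leP => [|i]; first by rewrite mulr_ge0// ltW// side_gt0.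
have := hy i; have := hz i; rewrite !mxE => /andP[h1 h2] /andP[h3 h4].
rewrite -(ler_pM2l B0) mulrCA mulfV ?gt_eqF// mulr1.
rewrite -{1}(gtr0_norm B0) -normrM mulrBr ler_norml.
have hu : 0 <= ((u ord0 i : nat)%:R : R) <= (2 * N)%N%:R.
  by rewrite ler0n ler_nat -ltnS ltn_ord.
move: hu h3 h4; rewrite natrM !rmorphB !rmorphD/= -!pmulrn -natr1.
move=> /andP[? ?] h3 h4; apply/andP; split; lra.
Qed.

End CadicNeighbours.

Section UbiquityMeasure.
Context {R : realType} {d : nat}.
Variable m : {finite_measure set (borel R d) -> \bar R}.
Variable c : nat.
Hypothesis d0 : (0 < d)%N.
Hypothesis c1 : (1 < c)%N.
Local Notation cube := (@cube R d).

Let c0 : (0 < c)%N := ltnW c1.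

(** Both cubes are dilated onto the same unit cube. One half of (iv) on the second cube pushes the
    null set [A] to a null set there, and the other half on the first cube pulls it back; the
    composite of the two maps is the translation by [v]. *)
Lemma null_translate n k1 k2 (A : set 'rV[R]_d) :
  (forall j k, cadic c j k `<=` (hcube : set 'rV[R]_d) ->
    let m_dil := fun B : set (borel R d) =>
      m (cadic_dilation c j k @` (B `&` cadic c j k)) in
    let m_res := fun B : set (borel R d) => m (B `&` cadic c j k) in
    m_dil `<< m_res /\ m_res `<< m_dil) ->
  cube c n k1 `<=` hcube -> cube c n k2 `<=` hcube -> bmeasurable A -> m A = 0%E ->
  m (cube c n k1 `&` (fun y => y + (c%:R : R) ^- n *: zvec (k2 - k1)) @^-1` A) = 0%E.
Proof.
move=> dil sub1 sub2 mA A0; set v := _ *: zvec _.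
have [_ res1] := dil n%:Z k1 sub1; have [dil2 _] := dil n%:Z k2 sub2.
have mB := bmeasurable_shift v mA.
rewrite setIC; apply: (res1 ((fun y => y + v) @^-1` A)) => //.
(* Domination is applied to null sets in the hereditary sense: all measurable subsets have value
   0. *)
move=> B mB' BA.
have -> : cadic_dilation c n%:Z k1 @` (B `&` cadic c n%:Z k1) =
    cadic_dilation c n%:Z k2 @` ((fun y => y - v) @^-1` B `&` cadic c n%:Z k2).
  have E (y : 'rV[R]_d) : cadic_dilation c n%:Z k2 (y + v) = cadic_dilation c n%:Z k1 y.
    rewrite /cadic_dilation scalerDr /v scalerA -[(c%:R : R) ^ n%:Z]/(c%:R ^+ n).
    rewrite mulfV ?expf_neq0 ?pnatr_eq0 -?lt0n// scale1r zvecD zvecN.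
    by rewrite addrA addrAC addrK.
  have sh y : cube c n k2 (y + v) <-> cube c n k1 y.
    by rewrite -{1}[k2](subrK k1) addrC; exact: cube_translate.
  apply/seteqP; split=> _ [y [/= By cy] <-].
    by exists (y + v); [split => /=; [rewrite addrK|exact/sh]|exact: E].
  exists (y - v); last by rewrite -E subrK.
  by split => //; apply/sh; rewrite subrK.
apply: (dil2 A).
- move=> C mC CA; apply/eqP; rewrite eq_le measure_ge0 andbT -A0.
  apply: bmeasure_le => //; first by apply: measurableI => //; exact: bmeasurable_cube.
  by move=> x [/CA].
- exact: bmeasurable_shift.
- by move=> y /= /BA; rewrite /= subrK.
Qed.

Lemma ubiq_ocube_gt0 : ubiq_measure m -> (0 < m ocube)%E.
Proof.
move=> um; have : msupport m (const_mx 2^-1).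
  by rewrite um => i; rewrite mxE invr_ge0 ler0n invf_le1// ler1n.
apply; first exact: open_ocube.
by move=> i; rewrite mxE invr_gt0 ltr0n invf_lt1// ltr1n.
Qed.

(** The generation in (ii) is made uniform: [G J] discards all points of heavy cubes of generation
    at least J. Almost every point of the open cube survives for some J, and the open cube has
    positive measure, so some [G J] does too. *)
Lemma frostman_set beta phi : ubiq_measure m ->
  {ae m, forall x : 'rV[R]_d, ccube x ->
    eventually_near c x (fun j k =>
      (m (cadic c j k) <= (hgauge beta phi (diam (cadic c j k)))%:E)%E)} ->
  exists J (G : set 'rV[R]_d), [/\ bmeasurable G, G `<=` hcube, (0 < m G)%E &
    forall n k, (J <= n)%N ->
      (m (G `&` cube c n k) <= (hgauge beta phi (c%:R ^- n))%:E)%E].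
Proof.
move=> um near_ae; pose h n : R := hgauge beta phi (c%:R ^- n).
pose heavy n k : set 'rV[R]_d := if `[< cube c n k `<=` hcube /\
  ~ (m (cube c n k) <= (h n)%:E)%E >] then cube c n k else set0.
pose bad n := \bigcup_k heavy n k.
pose G J : set 'rV[R]_d := hcube `\` \bigcup_(n in [set n | (J <= n)%N]) bad n.
have mheavy n k : bmeasurable (heavy n k).
  by rewrite /heavy; case: ifP => _; [exact: bmeasurable_cube|exact: measurable0].
have mbad n : bmeasurable (bad n).
  apply: countable_bigcupT_measurable; first exact: countableP.
  by move=> k; exact: mheavy.
have mG J : bmeasurable (G J).
  apply: measurableD; first exact: bmeasurable_hcube.
  by apply: bigcup_measurable => n _; exact: mbad.
have [J GJ] : exists J, (0 < m (G J))%E.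
  apply: contrapT => /forallNP G0.
  have negG J : m.-negligible (G J).
    exists (G J); split => //; first exact: mG.
    by apply/eqP; rewrite eq_le measure_ge0 andbT leNgt; apply/negP/G0.
  have : m.-negligible ocube.
    apply: negligibleS (negligibleU near_ae (negligible_bigcup negG)).
    move=> x ox; have hx : hcube x by move=> i; have /andP[/ltW -> ->] := ox i.
    have [P|P] := pselect (ccube x -> eventually_near c x (fun j k =>
      (m (cadic c j k) <= (hgauge beta phi (diam (cadic c j k)))%:E)%E)); last by left.
    right; have [|j0 near] := P.
      by move=> i; have /andP[/ltW -> /ltW ->] := ox i.
    exists (absz j0) => //; split => // -[n /= jn [k _]].
    rewrite /heavy; case: asboolP => // -[sub hvy] xk; apply: hvy.
    rewrite /h -(@diam_cube R d c n k)//; apply: near.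
    + by apply: le_trans (ler_norm _) _; rewrite -abszE.
    + exact: cube_range xk hx.
    + apply: cube_sub_cadic3 => // i.
      have /(cubeP _ _ _ c0) -> := xk.
      by rewrite /cubeidx subrr normr0.
  move=> /negligible_null_set/(_ ocube (bmeasurable_open open_ocube) (@subset_refl _ _)).
  by move=> o0; have := ubiq_ocube_gt0 um; rewrite o0 ltxx.
exists J, (G J); split => // [x []//|n k Jn].
have hn0 : 0 <= h n by rewrite ltW// hgauge_gt0// side_gt0.
(* A cube meeting [G J] is contained in the unit cube and, for n >= J, cannot be heavy. *)
have small : ~ (cube c n k `<=` hcube /\ ~ (m (cube c n k) <= (h n)%:E)%E) ->
    (G J `&` cube c n k) !=set0 -> (m (G J `&` cube c n k) <= (h n)%:E)%E.
  move=> nh [x [[hx _] xk]].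
  have sub := cube_sub_hcube c0 xk hx.
  apply: (@le_trans _ _ (m (cube c n k))).
    apply: bmeasure_le; [|exact: bmeasurable_cube|exact: subIsetr].
    by apply: measurableI; [exact: mG|exact: bmeasurable_cube].
  by apply: contrapT => nle; apply: nh.
have [E|/set0P ne] := eqVneq (G J `&` cube c n k) set0; first by rewrite E measure0 lee_fin.
apply: small => // hvy; case: ne => x [[hx nb] xk]; apply: nb.
by exists n => //; exists k => //; rewrite /heavy asboolT.
Qed.

End UbiquityMeasure.

Section Scaling.
Context {R : realType} {d : nat} {I : Type}.
Variables (xs : I -> 'rV[R]_d) (rs : I -> R).
Variable mu : {finite_measure set (borel R d) -> \bar R}.
Variables (alpha : R) (psi : R -> R) (c : nat).
Hypothesis d0 : (0 < d)%N.
Hypothesis c1 : (1 < c)%N.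
Hypothesis alpha_gt0 : 0 < alpha.
Hypothesis psiP : PsiClass psi.

Let c0 : (0 < c)%N := ltnW c1.

Let near_scaling (x : 'rV[R]_d) := eventually_near c x (fun j k =>
  let delta := diam (cadic c j k) in
  ((delta `^ (alpha + psi delta))%:E <= mu (cadic c j k))%E /\
  (mu (cadic c j k) <= (delta `^ (alpha - psi delta))%:E)%E).

(** Since x is within r_i / 2 of x_i, the ball B(x_i, r_i) contains a c-adic cube around x of
    comparable size, while its closure is covered by 3^d neighbouring cubes of side between 2 r_i
    and 2 c r_i. The interior position of x keeps these in the unit cube. [M] does not depend on x;
    only the threshold on the radius does. *)
Lemma scaling_near : exists2 M : R, 1 <= M & forall x, ocube x -> near_scaling x ->
  exists2 delta, 0 < delta & forall i, 0 < rs i -> rs i < delta ->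
    `|x - xs i| <= rs i / 2 -> scaling_indices xs rs mu alpha M psi i.
Proof.
have [psi0 [rho [rho0 [_ psi_mono] psi_pow]]] := psiP.
have psi_ge0 r : 0 <= r -> r <= rho -> 0 <= psi r.
  by move=> r0 rr; rewrite -psi0; apply: psi_mono; rewrite ?in_itv/= ?lexx ?r0 ?rr ?(ltW rho0).
have c0R : 0 < c%:R :> R by rewrite ltr0n.
have c1R : 1 <= c%:R :> R by rewrite ler1n.
(* [M1] pays for the 3^d neighbours of side at most c * s in the upper bound; [M2] for s <= 4 * c *
   q, with q the side of the inner cube, in the lower one. *)
pose M1 : R := (3 ^ d)%:R * c%:R `^ alpha.
pose M2 : R := (4 * c%:R) `^ (alpha + psi rho).
have M1_ge1 : 1 <= M1.
  apply: mulr_ege1; first by rewrite ler1n expn_gt0.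
  by apply: (@le_trans _ _ ((c%:R : R) `^ 0)); [rewrite powRr0|apply: ler_powR => //; exact: ltW].
have M2_ge0 : 0 <= M2 by rewrite powR_ge0.
exists (M1 + M2); first by rewrite -[1]addr0 lerD.
have M0 : 0 < M1 + M2 by rewrite ltr_pwDl// (lt_le_trans ltr01).
move=> x ox [j0 hj0].
have hx : hcube x by move=> i; have /andP[/ltW -> ->] := ox i.
have [eta /= eta0 eta_sub] : exists2 e : R, 0 < e & ball x e `<=` ocube.
  by have := @open_ocube R d; rewrite openE => /(_ _ ox) /nbhs_ballP[e e0 eU]; exists e.
pose n0 := absz j0.
have near n (k : 'rV[int]_d) : (n0 <= n)%N -> (forall i, `|k ord0 i - cubeidx c n x ord0 i| <= 1) ->
    cube c n k `<=` (hcube : set 'rV[R]_d) ->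
    (((c%:R ^- n) `^ (alpha + psi (c%:R ^- n)))%:E <= mu (cube c n k))%E /\
    (mu (cube c n k) <= ((c%:R ^- n) `^ (alpha - psi (c%:R ^- n)))%:E)%E.
  move=> n0n hk sub; rewrite -(@diam_cube R d c n k)//; apply: hj0.
  - by apply: le_trans (ler_norm _) _; rewrite -abszE.
  - have [y hy] := @cube_nonempty R d c n k c0.
    by apply: cube_range hy (sub _ hy).
  - by apply: cube_sub_cadic3.
(* Below [D], the generation is late enough for (iii), neighbouring cubes stay in the unit cube,
   [psi] is monotone and sides are less than 1. The denominator 2 * c used next gives c * s < D,
   which bounds every side below. *)
pose D : R := Num.min (Num.min (c%:R ^- n0) (eta / 2)) (Num.min rho 1).
have D0 : 0 < D by rewrite !lt_min side_gt0// divr_gt0// rho0 ltr01.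
exists (D / (2 * c%:R)); first by rewrite divr_gt0// mulr_gt0.
move=> i r0 rD xi; set r := rs i in r0 rD xi *; pose s := 2 * r.
have s0 : 0 < s by rewrite mulr_gt0.
have csD : c%:R * s < D by move: rD; rewrite ltr_pdivlMr ?mulr_gt0// /s; lra.
have := csD; rewrite !lt_min => /andP[/andP[cs1 cs2] /andP[cs3 cs4]].
have scs : s <= c%:R * s by rewrite ler_peMl// ltW.
have srho : s <= rho by apply: ltW; exact: le_lt_trans cs3.
have s1 : s <= 1 by apply: ltW; exact: le_lt_trans cs4.
have mball : bmeasurable (ball (xs i) r) by apply: bmeasurable_open; exact: ball_open.
have mcball : bmeasurable (closed_ball (xs i) r).
  by apply: bmeasurable_closed; exact: closed_ball_closed.
have n0P n : c%:R ^- n < D -> (n0 <= n)%N.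
  by rewrite !lt_min => /andP[/andP[h _] _]; rewrite -(@side_leE R _ _ _ c1) ltW.
have lower : (((M1 + M2)^-1 * s `^ (alpha + psi s))%:E <= mu (ball (xs i) r))%E.
  have [||n [nr rn]] := @side_between R c (r / 2) c1; first by rewrite divr_gt0.
    by move: s1; rewrite /s; lra.
  set q := c%:R ^- n in nr rn; have q0 : 0 < q by exact: side_gt0.
  have qs : q <= s by rewrite /s; lra.
  have qD : q < D by apply: le_lt_trans csD; exact: le_trans scs.
  have sub : cube_at c n x `<=` hcube by apply: cube_sub_hcube hx => //; exact: cube_self.
  have [|h _] := near n (cubeidx c n x) (n0P _ qD) _ sub.
    by move=> l; rewrite subrr normr0.
  apply: (@le_trans _ _ (mu (cube_at c n x))); last first.
    apply: bmeasure_le => //; first exact: bmeasurable_cube.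
    move=> y /(cube_dist c0 (cube_self n x c0)); rewrite -/q -ball_normE /= => xy.
    apply: le_lt_trans (ler_distD x _ _) _; rewrite [X in X + _]distrC.
    by apply: (@lt_le_trans _ _ (r / 2 + r / 2)); [apply: ler_ltD => //; exact: lt_le_trans nr|lra].
  apply: le_trans h; rewrite -/q lee_fin ler_pdivrMl//.
  have es : 0 <= alpha + psi s by rewrite addr_ge0 ?(ltW alpha_gt0)// psi_ge0// ltW.
  apply: (@le_trans _ _ ((4 * c%:R * q) `^ (alpha + psi s))).
    apply: ge0_ler_powR; rewrite ?nnegrE ?(ltW s0)//.
      by rewrite !mulr_ge0// ltW.
    by rewrite /s; lra.
  rewrite powRM ?mulr_ge0 ?(ltW q0)//; apply: ler_pM; rewrite ?powR_ge0//.
    apply: (@le_trans _ _ M2); last by rewrite lerDr (le_trans ler01).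
    apply: ler_powR; first by lra.
    by rewrite lerD2l; apply: psi_mono; rewrite ?in_itv/= ?(ltW s0) ?srho ?lexx ?(ltW rho0).
  apply: ger_powR; first by rewrite q0 (le_trans qs).
  rewrite lerD2l; apply: psi_mono; rewrite ?in_itv/= ?(ltW s0) ?srho ?(ltW q0)//.
  exact: le_trans srho.
have upper : (mu (closed_ball (xs i) r) <= ((M1 + M2) * s `^ (alpha - psi s))%:E)%E.
  have [//|//|n [sq qs]] := @side_between_gt R c s c1.
  set q := c%:R ^- n in sq qs; have q0 : 0 < q by exact: side_gt0.
  have qD : q < D by exact: lt_trans csD.
  have qrho : q <= rho by apply: ltW; exact: lt_trans cs3.
  apply: (@le_trans _ _ (mu (setT `&` [set y | `|y - x| <= 1%:R * c%:R ^- n]%R))).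
    apply: bmeasure_le => //; first by rewrite setTI; exact: bmeasurable_ball.
    move=> y; rewrite closed_ballE// /closed_ball_ /= => xy; split => //=.
    rewrite -/q mul1r; apply: le_trans sq; rewrite /s.
    apply: le_trans (ler_distD (xs i) _ _) _; rewrite [X in X + _]distrC [X in _ + X]distrC.
    by move: r0; lra.
  apply: (@le_trans _ _ (((2 * 1).+1 ^ d)%N%:R * q `^ (alpha - psi q))%:E).
    apply: measure_ball_le => //; first exact: measurableT.
    move=> u; rewrite setTI.
    have [||_] := near n (\row_i (cubeidx c n x ord0 i + (u ord0 i : nat)%:Z - 1%N%:Z)) (n0P _ qD).
    - move=> l; rewrite mxE ler_norml.
      move: (cubeidx c n x ord0 l) (nat_of_ord (u ord0 l)) (ltn_ord (u ord0 l)) => e a ha.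
      by clear -ha; lia.
    - move=> y /(near_cube_dist c0) h.
      have /eta_sub oy : ball x eta y.
        rewrite -ball_normE /= distrC; apply: le_lt_trans h _.
        by move: (lt_trans qs cs2); rewrite -/q; lra.
      by move=> l; have /andP[/ltW -> ->] := oy l.
    - by [].
  rewrite lee_fin; apply: (@le_trans _ _ (M1 * s `^ (alpha - psi s))); last first.
    by rewrite ler_wpM2r ?powR_ge0// lerDl.
  rewrite -mulrA ler_wpM2l//.
  rewrite powRD ?(gt_eqF q0) ?implybT// powRD ?(gt_eqF s0) ?implybT//.
  rewrite mulrA; apply: ler_pM; rewrite ?powR_ge0//.
    rewrite -powRM ?(ltW s0) ?(ltW c0R)//; apply: ge0_ler_powR; rewrite ?nnegrE ?(ltW alpha_gt0) ?(ltW q0) ?(ltW qs)//.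
    by rewrite mulr_ge0// ltW.
  apply: psi_pow; rewrite ?in_itv/= ?s0 ?srho ?q0//.
split => //; apply: bmeasure_le => //; exact: subset_closed_ball.
Qed.

(** Only finitely many radii exceed the threshold at x, so discarding those indices leaves
    infinitely many. *)
Lemma scaling_ae (m : {finite_measure set (borel R d) -> \bar R}) :
  null_family xs rs ->
  {ae m, forall x : 'rV[R]_d, ccube x ->
    infinite_set [set i | `|x - xs i| <= rs i / 2]} ->
  {ae m, forall x : 'rV[R]_d, ccube x -> near_scaling x} ->
  exists2 M, 1 <= M & {ae m, forall x : 'rV[R]_d, ocube x ->
    infinite_set [set i | scaling_indices xs rs mu alpha M psi i /\ `|x - xs i| <= rs i / 2]}.
Proof.
move=> [xsr rs0] inf_ae near_ae; have [M M1 MP] := scaling_near.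
exists M => //; apply: negligibleS (negligibleU inf_ae near_ae) => x /= hx.
apply: contrapT => /not_orP[/contrapT hinf /contrapT hnear]; apply: hx => ox.
have cx : ccube x by move=> i; have /andP[/ltW -> /ltW ->] := ox i.
have [delta delta0 dP] := MP x ox (hnear cx).
move=> fin; apply: (hinf cx).
apply: (@sub_finite_set _ _ ([set i | scaling_indices xs rs mu alpha M psi i /\
  `|x - xs i| <= rs i / 2] `|` [set i | delta / 2 < rs i])); last first.
  by rewrite finite_setU; split => //; apply: rs0; rewrite divr_gt0.
move=> i /= xi; have [ri|ri] := ltP (delta / 2) (rs i); [by right|left].
split => //; apply: dP => //; first by have [] := xsr i.
by apply: le_lt_trans ri _; lra.
Qed.

End Scaling.

(** * Separated balls and local masses *)

Section Selection.
Context {R : realType} {d : nat}.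
Variables (x : nat -> 'rV[R]_d) (r : nat -> R).
Hypothesis r_gt0 : forall i, 0 < r i.

Lemma seq_argmax (s : seq nat) : s != [::] ->
  exists2 i, i \in s & forall l, l \in s -> r l <= r i.
Proof.
elim: s => // i s ih _; have [->|/ih[l ls lmax]] := eqVneq s [::].
  by exists i; rewrite ?mem_head// => l; rewrite inE => /eqP->.
have [il|li] := leP (r i) (r l).
  by exists l; rewrite ?inE ?ls ?orbT// => k; rewrite inE => /orP[/eqP->//|/lmax].
exists i; rewrite ?mem_head// => k; rewrite inE => /orP[/eqP->//|/lmax h].
by apply: le_trans h _; exact: ltW.
Qed.

(* Greedy selection by decreasing radius: the selected balls of radius [r i / 4]
   are disjoint, yet the selected balls of radius [r k] swallow all the given
   balls of radius [r i / 2]. *)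
Lemma separated_selection (s : seq nat) : exists t : seq nat,
  [/\ uniq t, {subset t <= s},
    forall i l, i \in t -> l \in t -> i != l -> r i / 2 < `|x i - x l| &
    forall i, i \in s -> exists2 k, k \in t & `|x i - x k| <= r k / 2 /\ r i <= r k].
Proof.
have [n] := ubnP (size s); elim: n s => // n ih s; rewrite ltnS => sn.
have [->|s0] := eqVneq s [::]; first by exists [::].
have [i0 i0s imax] := seq_argmax s0.
pose s' := [seq i <- s | r i0 / 2 < `|x i - x i0|].
have i0s' : i0 \notin s'.
  by rewrite mem_filter subrr normr0 ltNge ltW// divr_gt0.
have [|t [ut ts' sep cov]] := ih s'.
  apply: leq_trans sn; rewrite size_filter ltn_neqAle count_size andbT -all_count.
  by apply: contra i0s' => /allP/(_ _ i0s) far; rewrite mem_filter far.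
exists (i0 :: t); split.
- by rewrite /= ut andbT; apply: contra i0s'; exact: ts'.
- move=> i; rewrite inE => /orP[/eqP->//|/ts'].
  by rewrite mem_filter => /andP[].
- have far i : i \in t -> r i0 / 2 < `|x i - x i0|.
    by move=> /ts'; rewrite mem_filter => /andP[].
  have small i : i \in t -> r i <= r i0.
    by move=> /ts'; rewrite mem_filter => /andP[_ /imax].
  move=> i l; rewrite !inE => /orP[/eqP->|it] /orP[/eqP->|lt]; rewrite ?eqxx//.
  + by move=> _; rewrite distrC; exact: far.
  + move=> _; apply: le_lt_trans (far _ it); have := small _ it; lra.
  + exact: sep.
- move=> i si; have [near|far] := leP `|x i - x i0| (r i0 / 2).
    by exists i0; rewrite ?mem_head//; split => //; exact: imax.
  have [|k kt h] := cov i; first by rewrite mem_filter far.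
  by exists k; rewrite // inE kt orbT.
Qed.

End Selection.

Section LocalMass.
Context {R : realType} {d : nat}.
Variable m : {finite_measure set (borel R d) -> \bar R}.
Implicit Types (A E : set 'rV[R]_d).

Lemma bmeasureU A E : bmeasurable A -> bmeasurable E -> A `&` E = set0 ->
  m (A `|` E) = (m A + m E)%E.
Proof. exact: measureU. Qed.

Lemma measure_seq_disjoint (T : eqType) (t : seq T) (D : T -> set 'rV[R]_d) E :
  uniq t -> bmeasurable E -> (forall i, bmeasurable (D i)) ->
  (forall i, i \in t -> D i `<=` E) ->
  (forall i l y, i \in t -> l \in t -> D i y -> D l y -> i = l) ->
  (\sum_(i <- t) m (D i) <= m E)%E.
Proof.
move=> + + mD; elim: t E => [|i t ih] E; first by rewrite big_nil measure_ge0.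
move=> /= /andP[it ut] mE DE dis; rewrite big_cons.
have mED : bmeasurable (E `\` D i) by apply: bmeasurableD.
apply: (@le_trans _ _ (m (D i) + m (E `\` D i))%E).
  apply: leeD2l; apply: ih => //.
    move=> l lt y Dy; split; first by apply: (DE l) => //; rewrite inE lt orbT.
    move=> Diy; move: it; rewrite (dis i l y) ?lt// ?inE ?eqxx ?lt ?orbT//.
  by move=> k l y kt lt; apply: dis; rewrite inE ?kt ?lt orbT.
rewrite -bmeasureU//; last by apply/seteqP; split => // y [Dy [_ /(_ Dy)]].
apply: bmeasure_le => //; first exact: bmeasurableU.
by move=> y [|[]//]; apply: DE; rewrite mem_head.
Qed.

(** Nothing bounds m(G /\ Q) from below in terms of h, so masses are compared with a reference cube
    whose ratio m(G /\ Q)/h exceeds half of the supremum; this is the origin of the factor 2. The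
    supremum is at most 1 by hypothesis. *)
Lemma frostman_choice (c J : nat) (h : R -> R) (G : set 'rV[R]_d) :
  (1 < c)%N -> (forall n, 0 < h (c%:R ^- n)) ->
  bmeasurable G -> G `<=` hcube -> (0 < m G)%E ->
  (forall n k, (J <= n)%N -> (m (G `&` cube c n k) <= (h (c%:R ^- n))%:E)%E) ->
  exists j k, [/\ (J <= j)%N, (0 < m (G `&` cube c j k))%E &
    forall n k', (J <= n)%N -> (m (G `&` cube c n k') <=
      (2 * fine (m (G `&` cube c j k)) * h (c%:R ^- n) / h (c%:R ^- j))%:E)%E].
Proof.
move=> c1 h0 mG Gh G0 Gh_le; have c0 := ltnW c1.
have mGc n k : bmeasurable (G `&` cube c n k).
  exact: bmeasurableI mG (bmeasurable_cube _ _ c0).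
pose f n k := fine (m (G `&` cube c n k)).
have fE n k : m (G `&` cube c n k) = (f n k)%:E by rewrite fineK// bmeasure_fin_num.
have f_ge0 n k : 0 <= f n k by rewrite fine_ge0.
pose E := [set f nk.1 nk.2 / h (c%:R ^- nk.1) | nk in
  [set nk : nat * 'rV[int]_d | (J <= nk.1)%N]].
have ubE : ubound E 1.
  move=> _ [[n k] /= Jn <-]; rewrite ler_pdivrMr// mul1r -lee_fin -fE.
  exact: Gh_le.
(* Otherwise the finitely many cubes of generation J covering the unit cube, contained in a ball of
   radius c^J * c^-J = 1, would all miss [G] up to a null set. *)
have [k0 fk0] : exists k, 0 < f J k.
  apply: contrapT => /forallNP f0; move: G0; apply/negP; rewrite -leNgt.
  apply: (@le_trans _ _ (m (G `&` [set y | `|y - 0| <= (c ^ J)%N%:R * c%:R ^- J]%R))).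
    apply: bmeasure_le => //; first by apply: bmeasurableI => //; exact: bmeasurable_ball.
    move=> y Gy; split => //=; rewrite natrX mulfV ?expf_neq0 ?pnatr_eq0 -?lt0n// subr0.
    apply/norm_leP => // i; have /andP[y0 /ltW y1] := Gh _ Gy i.
    by rewrite ger0_norm.
  apply: le_trans (measure_ball_le c0 mG (B := 0) _) _; last by rewrite mulr0.
  by move=> u; rewrite /near_cube fE lee_fin leNgt; apply/negP; exact: f0.
have Ein n k : (J <= n)%N -> E (f n k / h (c%:R ^- n)) by move=> Jn; exists (n, k).
have ubd : has_ubound E by exists 1.
have hs : has_sup E by split=> //; exists (f J k0 / h (c%:R ^- J)); exact: Ein.
have s0 : 0 < sup E.
  apply: lt_le_trans (sup_ubound ubd (Ein J k0 (leqnn J))).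
  by rewrite divr_gt0.
have [_ [[j k] /= Jj <-] hjk] : exists2 y, E y & sup E / 2 < y.
  by apply: sup_gt; [have [] := hs|lra].
exists j, k; split => //.
  rewrite fE lte_fin -(pmulr_lgt0 _ (_ : 0 < (h (c%:R ^- j))^-1)) ?invr_gt0//.
  by apply: lt_trans hjk; rewrite divr_gt0.
move=> n k' Jn; rewrite fE lee_fin -/(f j k) mulrAC -ler_pdivrMr//.
have h1 : f n k' / h (c%:R ^- n) <= sup E by exact: (sup_ubound ubd (Ein n k' Jn)).
by apply: le_trans h1 _; lra.
Qed.

Variables (x : nat -> 'rV[R]_d) (r : nat -> R) (P : nat -> Prop).
Hypothesis r_gt0 : forall i, 0 < r i.

(** A covering argument needing no doubling property of [m]. By continuity from below, finitely many
    half-radius balls already catch half of the mass; the selected full balls swallow them, and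
    their traces on [A] are then made disjoint. *)
Lemma local_mass A N (v : 'rV[R]_d) n0 delta :
  bmeasurable A -> (0 < m A)%E -> bmeasurable N -> m N = 0%E ->
  (forall y, A y -> ~ N y -> exists i,
     [/\ (n0 <= i)%N, P i, r i <= delta & `|y + v - x i| <= r i / 2]) ->
  exists (t : seq nat) (D : nat -> set 'rV[R]_d),
  [/\ uniq t,
    forall i, i \in t -> [/\ (n0 <= i)%N, P i, r i <= delta &
      exists2 y, A y & `|y + v - x i| <= r i / 2],
    forall i l, i \in t -> l \in t -> i != l -> r i / 2 < `|x i - x l|,
    [/\ forall i, bmeasurable (D i),
      forall i, D i `<=` A `&` [set y | `|y + v - x i| <= r i] &
      forall i l y, i \in t -> l \in t -> D i y -> D l y -> i = l] &
    fine (m A) / 2 <= \sum_(i <- t) fine (m (D i))].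
Proof.
move=> mA A0 mN N0 hit.
pose ok i := `[< [/\ (n0 <= i)%N, P i, r i <= delta &
  exists2 y, A y & `|y + v - x i| <= r i / 2] >].
pose C i : set 'rV[R]_d := if ok i then A `&` [set y | `|y + v - x i| <= r i / 2] else set0.
have mB i e : bmeasurable [set y | `|y + v - x i| <= e].
  rewrite (_ : mkset _ = [set y | `|y - (x i - v)| <= e]); first exact: bmeasurable_ball.
  by apply/seteqP; split => y /=; rewrite opprB addrA.
have mC i : bmeasurable (C i).
  by rewrite /C; case: ifP => _; [apply: bmeasurableI|exact: measurable0].
pose F n := \bigcup_(i in `I_n) C i.
have mF n : bmeasurable (F n) by apply: bigcup_measurable => i _; exact: mC.
have mUF : bmeasurable (\bigcup_n F n) by apply: bigcupT_measurable => i; exact: mF.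
have AF : (m A <= m (\bigcup_n F n))%E.
  apply: (@le_trans _ _ (m (A `\` N))); last first.
    apply: bmeasure_le => //; first exact: bmeasurableD.
    move=> y [Ay Ny]; have [i [ni Pi ri yi]] := hit y Ay Ny.
    exists i.+1 => //; exists i; first by rewrite /= ltnS.
    rewrite /C /ok asboolT//; split => //; by exists y.
  apply: (@le_trans _ _ (m (A `\` N) + m N)%E); last by rewrite N0 adde0.
  rewrite -bmeasureU//; [|exact: bmeasurableD|by apply/seteqP; split => // y [[_ /[apply]]]].
  apply: bmeasure_le => //; first by apply: bmeasurableU => //; exact: bmeasurableD.
  by move=> y Ay; have [Ny|Ny] := pselect (N y); [right|left].
have cvF : (m \o F) n @[n --> \oo] --> m (\bigcup_n F n).
  apply: nondecreasing_cvg_mu => // p q pq.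
  by apply/subsetPset => y [i /= ip Ciy]; exists i => //=; exact: leq_trans ip pq.
have [n hn] : exists n, fine (m A) / 2 <= fine (m (F n)).
  apply: contrapT => /forallNP hF.
  have Aa : m A = (fine (m A))%:E by rewrite fineK// bmeasure_fin_num.
  have a0 : 0 < fine (m A) by rewrite -lte_fin -Aa.
  have : (m (\bigcup_n F n) <= (fine (m A) / 2)%:E)%E.
    rewrite -(cvg_lim _ cvF)//; apply: lime_le; first exact: cvgP cvF.
    apply: nearW => n /=; rewrite -[m (F n)]fineK ?bmeasure_fin_num// lee_fin leNgt; apply/negP => /ltW.
    exact: hF.
  move=> /(le_trans AF); rewrite Aa lee_fin; lra.
have [t [ut ts sep cov]] := separated_selection x r_gt0 [seq i <- iota 0 n | ok i].
have tok i : i \in t -> [/\ (n0 <= i)%N, P i, r i <= delta &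
      exists2 y, A y & `|y + v - x i| <= r i / 2].
  by move=> /ts; rewrite mem_filter => /andP[/asboolP].
pose B i : set 'rV[R]_d := [set y | `|y + v - x i| <= r i].
(* Each point is assigned to the selected ball of least index containing it. *)
pose D i := (A `&` B i) `\` \bigcup_(l in [set l | (l \in t) && (l < i)%N]) B l.
have mD i : bmeasurable (D i).
  apply: bmeasurableD; first by apply: bmeasurableI => //; exact: mB.
  by apply: bigcup_measurable => l _; exact: mB.
exists t, D; split => //.
  split=> [//|i y []//|i l y it lt [[_ Bi] Di] [[_ Bl] Dl]].
  have [il|li|//] := ltngtP i l.
    by case: Dl; exists i => //=; rewrite it.
  by case: Di; exists l => //=; rewrite lt.
apply: le_trans hn _; rewrite -lee_fin fineK ?bmeasure_fin_num// -sumEFin.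
under [leRHS]eq_bigr do rewrite fineK ?bmeasure_fin_num//.
apply: measure_seq_cover => // y [i /= ip].
rewrite /C; case: ifPn => // oki [Ay yi].
have [|k kt [xik rik]] := cov i; first by rewrite mem_filter oki mem_iota.
have ex : exists l, (l \in t) && `[< B l y >].
  exists k; rewrite kt; apply/asboolP; rewrite /B /=.
  (* r_i / 2 + r_k / 2 <= r_k: this is where the half radius of hypothesis (i) is spent. *)
  apply: le_trans (ler_distD (x i) _ _) _; apply: le_trans (lerD yi xik) _; lra.
case: (ex_minnP ex) => l /andP[lt /asboolP Bl] lmin.
exists l => //; split => // -[p /= /andP[pt pl] Bp].
by have := lmin p; rewrite pt asboolT// => /(_ isT); rewrite leqNgt pl.
Qed.

End LocalMass.

(** * Subdivision of cubes *)

Section CubeCombinatorics.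
Context {R : realType} {d : nat}.
Local Notation cube := (@cube R d).

Lemma cube_gen_le b l n k1 k : (0 < d)%N -> (1 < b)%N ->
  cube b l k1 `<=` cube b n k -> (n <= l)%N.
Proof.
move=> d0 b1 sub; have b0 := ltnW b1; rewrite leqNgt; apply/negP => ln.
have B0 : 0 < (b%:R : R) ^+ l by rewrite exprn_gt0 // ltr0n.
pose pt (e : R) : 'rV[R]_d := \row_i ((k1 ord0 i)%:~R / b%:R ^+ l + e).
have ptin e : 0 <= e -> b%:R ^+ l * e < 1 -> cube b l k1 (pt e).
  move=> e0 e1; apply/cubeE => // i; rewrite mxE mulrDr mulrC divfK ?gt_eqF//.
  by rewrite lerDl mulr_ge0 ?(ltW B0)//= ltrD2l.
have s0 := @side_gt0 R b n b0.
have in1 : cube b l k1 (pt (b%:R ^- n)).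
  apply: ptin; first exact: ltW.
  rewrite mulrC -ltr_pdivlMr// div1r ltf_pV2 ?posrE ?exprn_gt0 ?ltr0n//.
  by rewrite ltr_eXn2l// ltr1n.
have in0 : cube b l k1 (pt 0) by apply: ptin; rewrite ?mulr0.
have := cube_dist b0 (sub _ in1) (sub _ in0); rewrite ltNge => /negP; apply.
apply: le_trans (coord_le_norm _ (Ordinal d0)); rewrite !mxE addr0 addrAC subrr add0r.
exact: ler_norm.
Qed.

(** Unrelated grids: a b-adic cube at least 4 times larger than the c-adic mesh contains some c-adic
    cube together with its neighbourhood of one mesh. *)
Lemma subcube_margin b c l j K : (0 < b)%N -> (0 < c)%N ->
  4 * (c%:R : R) ^- j <= b%:R ^- l ->
  exists k, forall y z, cube c j k y -> `|z - y| < c%:R ^- j -> cube b l K z.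
Proof.
move=> b0 c0 le4.
have B0 : 0 < (b%:R : R) ^+ l by rewrite exprn_gt0 // ltr0n.
have C0 : 0 < (c%:R : R) ^+ j by rewrite exprn_gt0 // ltr0n.
pose a i : R := (K ord0 i)%:~R / b%:R ^+ l.
(* In units of c^-j, the corner of [K] is below floor + 1, so index floor + 2 leaves one unit on the
   left. The cube ends at floor + 3, and one more unit stays within 4 of the corner. *)
exists (\row_i (Num.floor (c%:R ^+ j * a i) + 2)) => y z /(cubeE _ _ _ c0) hy hz.
apply/cubeE => // i.
have := hy i; rewrite !mxE rmorphD/= => /andP[y1 y2].
have /andP[f1 f2] := floor_itv (c%:R ^+ j * a i); rewrite intrD1 in f2.
have hzi : `|c%:R ^+ j * z ord0 i - c%:R ^+ j * y ord0 i| < 1.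
  rewrite -mulrBr normrM gtr0_norm// -ltr_pdivlMl// mulr1.
  by apply: le_lt_trans hz; have := coord_le_norm (z - y) i; rewrite !mxE.
move: hzi; rewrite ltr_norml => /andP[z1 z2].
have two : 2%:~R = 2 :> R by [].
rewrite two in y1 y2.
have lo : c%:R ^+ j * a i <= c%:R ^+ j * z ord0 i by lra.
have hi : c%:R ^+ j * z ord0 i < c%:R ^+ j * (a i + b%:R ^- l).
  rewrite mulrDr; have : 4 <= c%:R ^+ j * (b%:R : R) ^- l.
    by rewrite -ler_pdivrMl// mulrC.
  lra.
move: lo hi; rewrite ler_pM2l// ltr_pM2l// => lo hi.
rewrite -[(K ord0 i)%:~R](divfK (lt0r_neq0 B0)) -/(a i) mulrC ler_pM2l// lo /=.
have -> : b%:R ^+ l * a i + 1 = b%:R ^+ l * (a i + b%:R ^- l).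
  by rewrite mulrDr mulfV ?gt_eqF.
by rewrite ltr_pM2l.
Qed.

Section Subdivision.
Variables (b n l : nat) (K : 'rV[int]_d).
Hypothesis b0 : (0 < b)%N.
Hypothesis nl : (n <= l)%N.

Definition subcube (u : 'rV['I_(b ^ (l - n))]_d) : 'rV[int]_d :=
  \row_i (K ord0 i * (b ^ (l - n))%N%:Z + (u ord0 i : nat)%:Z).

Lemma subcube_inj : injective subcube.
Proof.
move=> u v /rowP uv; apply/rowP => i; have := uv i; rewrite !mxE.
by move=> /addrI[/val_inj].
Qed.

Lemma subcube_sub u : cube b l (subcube u) `<=` cube b n K.
Proof.
move=> y /(cubeE _ _ _ b0) hy; apply/cubeE => // i.
have := hy i; rewrite !mxE => /andP[h1 h2].
have B0 : 0 < (b%:R : R) ^+ (l - n) by rewrite exprn_gt0 // ltr0n.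
have E : b%:R ^+ l * y ord0 i = b%:R ^+ (l - n) * (b%:R ^+ n * y ord0 i).
  by rewrite mulrA -exprD subnK.
rewrite E rmorphD rmorphM/= -!pmulrn natrX in h1 h2.
have u0 : 0 <= ((u ord0 i : nat)%:R : R) by [].
have u1 : (u ord0 i : nat)%:R + 1 <= (b%:R : R) ^+ (l - n).
  by rewrite -natrX natr1 ler_nat.
apply/andP; split; rewrite -(ler_pM2l B0, ltr_pM2l B0) ?mulrDr mulrC ?mulr1; lra.
Qed.

(* Subcubes contained in [cube b n' k'] are determined by their offsets from its
   corner, each of which takes at most [b ^ (l - n')] values. *)
Lemma card_subcube n' k' : (n' <= l)%N ->
  (#|[pred u | `[< cube b l (subcube u) `<=` cube b n' k' >]]| <=
     b ^ ((l - n') * d))%N.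
Proof.
move=> n'l; have B'0 : (0 < b ^ (l - n'))%N by rewrite expn_gt0 b0.
have B0 : 0 < (b%:R : R) ^+ (l - n') by rewrite exprn_gt0 // ltr0n.
set A := [pred u | _].
have off u i : u \in A -> exists v : nat, (v < b ^ (l - n'))%N /\
    subcube u ord0 i = k' ord0 i * (b ^ (l - n'))%N%:Z + v%:Z.
  move=> /asboolP sub; have [y hy] := @cube_nonempty R d b l (subcube u) b0.
  have /(cubeE _ _ _ b0)/(_ i)/andP[h1 h2] := sub _ hy.
  have /(cubeE _ _ _ b0)/(_ i)/andP[h3 h4] := hy.
  have E : b%:R ^+ l * y ord0 i = b%:R ^+ (l - n') * (b%:R ^+ n' * y ord0 i).
    by rewrite mulrA -exprD subnK.
  have h5 : (k' ord0 i)%:~R * (b%:R : R) ^+ (l - n') <= b%:R ^+ l * y ord0 i.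
    by rewrite E [leRHS]mulrC ler_pM2r.
  have h6 : b%:R ^+ l * y ord0 i < ((k' ord0 i)%:~R + 1) * (b%:R : R) ^+ (l - n').
    by rewrite E [ltRHS]mulrC ltr_pM2l.
  have E2 : (b%:R : R) ^+ (l - n') = ((b ^ (l - n'))%N%:Z)%:~R by rewrite -pmulrn natrX.
  have lo : k' ord0 i * (b ^ (l - n'))%N%:Z < subcube u ord0 i + 1.
    by rewrite -(ltr_int R) rmorphM rmorphD/= -E2; exact: le_lt_trans h4.
  have hi : subcube u ord0 i < (k' ord0 i + 1) * (b ^ (l - n'))%N%:Z.
    by rewrite -(ltr_int R) rmorphM rmorphD/= -E2; exact: le_lt_trans h6.
  exists (absz (subcube u ord0 i - k' ord0 i * (b ^ (l - n'))%N%:Z)%R).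
  move: lo hi; move: (subcube u ord0 i) (k' ord0 i) (b ^ (l - n'))%N => s k B.
  by clear; rewrite mulrDl mul1r; move: (k * B%:Z) => p; lia.
pose f u : 'rV['I_(b ^ (l - n')).-1.+1]_d := \row_i inord
  (absz (subcube u ord0 i - k' ord0 i * (b ^ (l - n'))%N%:Z)%R).
have -> : (b ^ ((l - n') * d) = #|{: 'rV['I_(b ^ (l - n')).-1.+1]_d}|)%N.
  by rewrite card_mx card_ord prednK// mul1n expnM.
rewrite -(@card_in_image _ _ f A) ?max_card//.
move=> u v uA vA /rowP uv; apply: subcube_inj; apply/rowP => i.
have [p [pB Ep]] := off u i uA; have [q [qB Eq]] := off v i vA.
have fE w : f w ord0 i = inord
  (absz (subcube w ord0 i - k' ord0 i * (b ^ (l - n'))%N%:Z)%R) by rewrite [LHS]mxE.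
have := uv i; rewrite !fE Ep Eq addrAC subrr add0r addrAC subrr add0r !absz_nat.
by move=> /(congr1 val); rewrite /= !inordK ?prednK// => ->.
Qed.

End Subdivision.

End CubeCombinatorics.

(** * Mass families *)

Section OneStep.
Context {R : realType} {d : nat}.
Variable m : {finite_measure set (borel R d) -> \bar R}.
Variables (c : nat) (h : R -> R) (eh : R) (J : nat) (G N : set 'rV[R]_d).
Variables (x : nat -> 'rV[R]_d) (r : nat -> R) (P : nat -> Prop) (t : R).
Hypothesis d0 : (0 < d)%N.
Hypothesis c1 : (1 < c)%N.
Hypothesis h_gt0 : forall s, 0 < s -> 0 < h s.
Hypothesis eh_gt0 : 0 < eh.
Hypothesis h_reg : forall s s', 0 < s -> s <= s' -> s' < eh ->
  h s <= h s' /\ h s' / s' ^+ d <= h s / s ^+ d.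
Hypothesis mG : bmeasurable G.
Hypothesis G_hcube : G `<=` hcube.
Hypothesis G_gt0 : (0 < m G)%E.
Hypothesis G_le : forall n k, (J <= n)%N ->
  (m (G `&` cube c n k) <= (h (c%:R ^- n))%:E)%E.
Hypothesis dil : forall j k, cadic c j k `<=` (hcube : set 'rV[R]_d) ->
    let m_dil := fun B : set (borel R d) =>
      m (cadic_dilation c j k @` (B `&` cadic c j k)) in
    let m_res := fun B : set (borel R d) => m (B `&` cadic c j k) in
    m_dil `<< m_res /\ m_res `<< m_dil.
Hypothesis r_gt0 : forall i, 0 < r i.
Hypothesis mN : bmeasurable N.
Hypothesis N0 : m N = 0%E.
Hypothesis hit : forall y, ocube y -> ~ N y -> forall n0 delta, 0 < delta ->
  exists i, [/\ (n0 <= i)%N, P i, r i <= delta & `|y - x i| <= r i / 2].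
Hypothesis t_ge1 : 1 <= t.

Local Notation cube := (@cube R d).
Let c0 : (0 < c)%N := ltnW c1.

(** The intersection over [n0] of these sets is the limsup set; they play the role of [O] in the
    descent. *)
Definition hitting_tail n0 : set 'rV[R]_d :=
  [set y | exists i, [/\ (n0 <= i)%N, P i & `|y - x i| < r i `^ t]].

(* The number of c-adic cubes of generation [n] needed to cover a ball of radius
   [3 * c * c ^- n]. *)
Definition overlap : R := ((2 * (3 * c)).+1 ^ d)%N%:R.

Lemma overlap_ge1 : 1 <= overlap.
Proof. by rewrite ler1n expn_gt0. Qed.

Lemma mass_ball_le (z : 'rV[R]_d) (s : R) : 0 < s -> s <= c%:R ^- J -> s < eh ->
  (m (G `&` [set y | `|y - z| <= s]%R) <= (overlap * h s)%:E)%E.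
Proof.
move=> s0 sJ se.
have s1 : s <= 1 by apply: le_trans sJ _; rewrite -[leRHS]invr1 -[X in _ <= X^-1](expr0 c%:R) side_le.
have [n [ns sn]] := side_between c1 s0 s1.
have Jn : (J <= n)%N by rewrite -(@side_leE R _ _ _ c1) (le_trans ns).
have n0 := @side_gt0 R c n c0.
apply: (@le_trans _ _ (m (G `&` [set y | `|y - z| <= (3 * c)%N%:R * c%:R ^- n]%R))).
  apply: bmeasure_le; try by apply: bmeasurableI mG (bmeasurable_ball _ _).
  move=> y [Gy yz]; split => //=; apply: le_trans yz _; rewrite natrM -mulrA.
  by have := ltW sn; have : 0 < c%:R * (c%:R : R) ^- n by [apply: lt_trans sn]; lra.
apply: measure_ball_le => // u; apply: le_trans (G_le _ Jn) _.
by rewrite lee_fin; have [] := h_reg n0 ns se.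
Qed.

(** At scales finer than generation J1 the near-maximality of the reference cube applies; at coarser
    ones q >= c^-j, and the whole mass m(A) is already small enough because h(q) >= h(c^-j). *)
Lemma mass_cube_le J1 j k (q : R) (z : 'rV[R]_d) : (J1 <= j)%N -> 0 < q -> q < eh -> q <= 1 ->
  (forall n k', (J1 <= n)%N -> (m (G `&` cube c n k') <=
     (2 * fine (m (G `&` cube c j k)) * h (c%:R ^- n) / h (c%:R ^- j))%:E)%E) ->
  (m ((G `&` cube c j k) `&` [set y | `|y - z| <= 3 * q]%R) <=
     (2 * overlap * fine (m (G `&` cube c j k)) * h q / h (c%:R ^- j))%:E)%E.
Proof.
move=> J1j q0 qe q1 frost; set A := G `&` cube c j k in frost *.
have mA : bmeasurable A := bmeasurableI mG (bmeasurable_cube _ _ c0).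
have a0 : 0 <= fine (m A) by rewrite fine_ge0.
have [n [nq qn]] := side_between c1 q0 q1.
have n0 := @side_gt0 R c n c0; have j0 := @side_gt0 R c j c0.
have [hnq _] := h_reg n0 nq qe.
have [J1n|nJ1] := leqP J1 n.
  apply: (@le_trans _ _ (m (A `&` [set y | `|y - z| <= (3 * c)%N%:R * c%:R ^- n]%R))).
    apply: bmeasure_le; try by apply: bmeasurableI mA (bmeasurable_ball _ _).
    move=> y [Gy yz]; split => //=; apply: le_trans yz _; rewrite natrM -mulrA.
    by rewrite ler_pM2l// ltW.
  apply: (@le_trans _ _ (overlap * (2 * fine (m A) * h (c%:R ^- n) / h (c%:R ^- j)))%:E).
    apply: measure_ball_le => // u; rewrite /near_cube; set k' := \row_i _.
    apply: le_trans (frost _ k' J1n); apply: bmeasure_le; [|exact: bmeasurableI mG (bmeasurable_cube _ _ c0)|].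
      exact: bmeasurableI mA (bmeasurable_cube _ _ c0).
    by move=> y [[Gy _] ky].
  rewrite lee_fin !mulrA ler_wpM2r ?invr_ge0 ?(ltW (h_gt0 j0))//.
  by rewrite [overlap * 2]mulrC ler_wpM2l// !mulr_ge0.
apply: (@le_trans _ _ (m A)).
  by apply: bmeasure_le => //; exact: bmeasurableI mA (bmeasurable_ball _ _).
have jq : c%:R ^- j <= q.
  by apply: le_trans nq; rewrite side_le// (leq_trans (ltnW nJ1)).
have [hjq _] := h_reg j0 jq qe.
rewrite -[m A]fineK ?bmeasure_fin_num// lee_fin ler_pdivlMr ?h_gt0//.
have -> : 2 * overlap * fine (m A) * h q = (2 * overlap) * (fine (m A) * h q) by rewrite mulrA.
apply: (@le_trans _ _ (fine (m A) * h q)); first by rewrite ler_wpM2l.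
rewrite ler_peMl ?mulr_ge0 ?(ltW (h_gt0 q0))//.
by have := overlap_ge1; lra.
Qed.

Variables (b : nat) (g : R -> R).
Hypothesis b1 : (1 < b)%N.
Hypothesis gg : gauge d g.
Hypothesis g_large : forall K, exists2 e, 0 < e & forall q, 0 < q -> q < e ->
  K * h q <= g q /\ K * h q <= g (q `^ t).

Let b0 : (0 < b)%N := ltnW b1.

(** Builds the family in one subcube: the piece [A] is translated into it, and the mass of each
    selected ball is moved to a single cube of side about r_i^t around its centre. [W] is the
    density allowed by the later averaging over subcubes. *)
Lemma local_family J1 j k l K n0 W :
  (J1 <= j)%N -> (0 < m (G `&` cube c j k))%E ->
  (forall n k', (J1 <= n)%N -> (m (G `&` cube c n k') <=
     (2 * fine (m (G `&` cube c j k)) * h (c%:R ^- n) / h (c%:R ^- j))%:E)%E) ->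
  4 * (c%:R : R) ^- j <= b%:R ^- l -> (b%:R : R) ^- l < eh ->
  (b%:R : R) ^- l < eps_gauge d g ->
  0 < W ->
  (forall q, 0 < q -> q <= b%:R ^- l ->
     4 * overlap * h q / h (c%:R ^- j) <= W * g q) ->
  cube b l K `<=` hcube ->
  exists Z : seq ('rV[R]_d * nat * R),
  [/\ \sum_(z <- Z) z.2 = 1,
      forall z, z \in Z -> 0 <= z.2,
      forall z, z \in Z -> (l < z.1.2)%N /\
        [set y | `|y - z.1.1| <= side b z.1.2] `<=` cube b l K `&` hitting_tail n0 &
      forall n' k', (l <= n')%N ->
        (exists2 z, z \in Z & cube_at b z.1.2 z.1.1 `<=` cube b n' k') ->
        \sum_(z <- Z | `[< cube_at b z.1.2 z.1.1 `<=` cube b n' k' >]) z.2 <=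
          W * g (side b n')].
Proof.
move=> J1j A_gt0 frost le4 leh leps W0 hW subK.
set A := G `&` cube c j k in A_gt0 frost *; set a := fine (m A) in frost.
have mA : bmeasurable A := bmeasurableI mG (bmeasurable_cube _ _ c0).
have mAa : m A = a%:E by rewrite fineK// bmeasure_fin_num.
have a0 : 0 < a by rewrite -lte_fin -mAa.
have cj0 := @side_gt0 R c j c0.
have [k2 margin] := subcube_margin K b0 c0 le4.
set v : 'rV[R]_d := (c%:R : R) ^- j *: zvec (k2 - k).
have shift y : cube c j k y -> cube c j k2 (y + v).
  by move=> ky; rewrite -[k2](subrK k) addrC; apply/cube_translate.
have k2sub : cube c j k2 `<=` hcube.
  by move=> y ky; apply: subK; apply: (margin y y ky); rewrite subrr normr0.
have ksub : cube c j k `<=` hcube.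
  have [/eqP|/set0P[y [Gy ky]]] := eqVneq A set0; last exact: cube_sub_hcube ky (G_hcube Gy).
  by move=> /eqP E; move: A_gt0; rewrite E measure0 ltxx.
(* This constant is for a single large ball: 2 / a comes from normalization, [overlap] from
   [mass_ball_le], and (2b)^d from passing from r_i^t to the side of the tiny cube. *)
have [e2 e20 g2] := g_large (2 / a * overlap * (2 * b%:R) ^+ d / W).
pose delta := Num.min (Num.min (c%:R ^- j / 2) (e2 / 2)) (Num.min (Num.min (c%:R ^- J) 1) (eh / 2)).
have delta0 : 0 < delta by rewrite !lt_min !divr_gt0// side_gt0// ltr01.
have mN' := bmeasurableI (bmeasurable_cube j k c0) (bmeasurable_shift v mN).
have N'0 := null_translate c1 dil ksub k2sub mN N0.
have hitA y : A y -> ~ (cube c j k `&` (fun y => y + v) @^-1` N) y -> exists i,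
    [/\ (n0 <= i)%N, P i, r i <= delta & `|y + v - x i| <= r i / 2].
  move=> [Gy ky] ny; apply: hit => //; last by move=> Ny; apply: ny.
  (* [hit] requires the open cube, whereas [K] is only known to lie in the half-open one; the margin
     allows a shift by - c^-j / 2, which makes all coordinates positive. *)
  have hb e : `|e| < c%:R ^- j -> hcube (y + v + const_mx e).
    move=> ej; apply: subK; apply: (margin (y + v)); first exact: shift.
    rewrite addrC addKr; apply: le_lt_trans ej.
    by apply/norm_leP => // l'; rewrite mxE.
  have half : `|- ((c%:R : R) ^- j / 2)| < c%:R ^- j.
    by rewrite normrN gtr0_norm ?divr_gt0//; lra.
  have zero : `|0 : R| < c%:R ^- j by rewrite normr0.
  move=> l'; have /andP[h1 _] := hb _ half l'; have /andP[_ h2] := hb _ zero l'.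
  move: h1 h2; rewrite 2![(_ + const_mx _) ord0 l']mxE ![const_mx _ ord0 l']mxE.
  rewrite subr_ge0 addr0 => h1 ->; rewrite andbT; apply: lt_le_trans h1.
  by rewrite divr_gt0.
have [T [D [uT TP sep [mD DA disD] massT]]] := local_mass r_gt0 mA A_gt0 mN' N'0 hitA.
pose S : R := \sum_(i <- T) fine (m (D i)).
have S0 : 0 < S by apply: lt_le_trans massT; rewrite divr_gt0.
have rT i : i \in T -> [/\ r i <= c%:R ^- j / 2, r i < e2, r i <= c%:R ^- J, r i <= 1 & r i < eh].
  move=> /TP[_ _ + _]; rewrite !le_min => /andP[/andP[? ?] /andP[/andP[? ?] ?]].
  by split => //; lra.
have rt i : i \in T -> 0 < r i `^ t /\ r i `^ t <= r i.
  move=> /rT[_ _ _ r1 _]; split; first exact: powR_gt0.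
  by rewrite -[leRHS]powRr1 ?(ltW (r_gt0 i))//; apply: ger_powR; rewrite ?r_gt0.
have ch i : exists l', i \in T -> b%:R ^- l' <= r i `^ t / 2 /\ r i `^ t / 2 < b%:R * b%:R ^- l'.
  have [iT|] := boolP (i \in T); last by exists 0%N.
  have [rt0 rtr] := rt i iT; have [_ _ _ r1 _] := rT i iT.
  have [||l' hl'] := @side_between R b (r i `^ t / 2) b1; [by rewrite divr_gt0|lra|].
  by exists l'.
have {ch} [lf lfP] := choice ch.
pose w i := fine (m (D i)) / S.
have fD0 i : 0 <= fine (m (D i)) by rewrite fine_ge0.
exists [seq (x i, lf i, w i) | i <- T]; split.
- by rewrite big_map /= -mulr_suml mulfV// gt_eqF.
- by move=> _ /mapP[i iT ->] /=; rewrite divr_ge0// ltW.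
- move=> _ /mapP[i iT ->] /=.
  have [l1 l2] := lfP i iT; have [rt0 rtr] := rt i iT; have [rj _ _ _ _] := rT i iT.
  have [ni Pi _ [y [Gy ky] yi]] := TP i iT; split.
    by rewrite ltnNge -(@side_leE R _ _ _ b1) -ltNge; lra.
  move=> z; rewrite /side /= => zi; split; last first.
    by exists i; split => //; apply: le_lt_trans zi _; lra.
  apply: (margin (y + v)); first exact: shift.
  apply: le_lt_trans (ler_distD (x i) _ _) _; rewrite [X in _ + X]distrC.
  by apply: le_lt_trans (lerD zi yi) _; lra.
move=> n' k' ln'; have q0 := @side_gt0 R b n' b0; rewrite /side.
set q : R := b%:R ^- n' in q0 *.
have ql : q <= b%:R ^- l by rewrite side_le.
have qe : q < eh by exact: le_lt_trans leh.
have qeps : q < eps_gauge d g by exact: le_lt_trans leps.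
have q1 : q <= 1 by rewrite /q -[leRHS]invr1 -[X in _ <= X^-1](expr0 b%:R) side_le.
pose inQ i := `[< cube_at b (lf i) (x i) `<=` cube b n' k' >].
have inQx i : inQ i -> cube b n' k' (x i) by move=> /asboolP; apply; exact: cube_self.
have gq0 := gauge_gt0 gg q0 qeps.
rewrite big_map /= => -[_ /mapP[i1 i1T ->] /= /asboolP i1Q].
rewrite -/(inQ _) in i1Q *; under eq_bigl do rewrite -/(inQ _).
rewrite /w -mulr_suml.
apply: (@le_trans _ _ (2 / a * \sum_(i <- T | inQ i) fine (m (D i)))).
  rewrite mulrC ler_wpM2r ?sumr_ge0//.
  have -> : 2 / a = (a / 2)^-1 by rewrite invf_div.
  by rewrite lef_pV2 ?posrE// divr_gt0.
(* Either some ball centred in Q has radius above 2q: centres are more than r_i / 2 > q apart, so it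
   is alone in Q. Or all radii are at most 2q, and the traces fit in a ball of radius 3q. *)
have [/hasP[i iT /andP[iQ ri]]|big] := boolP (has (fun i => inQ i && (2 * q < r i)) T).
  have only l' : l' \in T -> inQ l' -> l' = i.
    move=> lT lQ; apply/eqP/negPn/negP => ne.
    have := sep i l' iT lT; rewrite eq_sym => /(_ ne); apply/negP; rewrite -leNgt.
    by have := ltW (cube_dist b0 (inQx _ iQ) (inQx _ lQ)); rewrite -/q; lra.
  rewrite big_mkcond (bigD1_seq i)//= iQ big_seq_cond big1 ?addr0; last first.
    move=> l' /andP[lT li]; case: ifP => // lQ.
    by rewrite (only _ lT lQ) eqxx in li.
  have [rj re2 rJ r1 reh] := rT i iT; have [rt0 rtr] := rt i iT.
  have [l1 l2] := lfP i iT.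
  have mDi : fine (m (D i)) <= overlap * h (r i).
    rewrite -lee_fin fineK ?bmeasure_fin_num//; apply: le_trans (mass_ball_le (x i - v) (r_gt0 i) rJ reh).
    apply: bmeasure_le => //; first exact: bmeasurableI mG (bmeasurable_ball _ _).
    by move=> y /DA[[Gy _] /= yi]; split => //=; rewrite opprB addrA.
  have lfn : (n' <= lf i)%N by exact: (cube_gen_le d0 b1 (asboolW iQ)).
  have [_ g2i] := g2 _ (r_gt0 i) re2.
  pose q' : R := r i `^ t / (2 * b%:R).
  have bR : 1 <= b%:R :> R by rewrite ler1n.
  have bR0 : 0 < b%:R :> R by rewrite ltr0n.
  have q'0 : 0 < q' by rewrite divr_gt0// mulr_gt0.
  have q'q : q' <= q.
    apply: (@le_trans _ _ (b%:R ^- lf i)); last by rewrite side_le.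
    by rewrite /q' ler_pdivrMr ?mulr_gt0//; move: l2; lra.
  have rteps : r i `^ t < eps_gauge d g.
    by apply: le_lt_trans leps; apply: le_trans le4; lra.
  have q'rt : q' <= r i `^ t by rewrite ler_pdivrMr ?mulr_gt0// ler_peMr ?(ltW rt0)//; lra.
  have gq' : g (r i `^ t) <= (2 * b%:R) ^+ d * g q'.
    have := gauge_ratio_le gg q'0 q'rt rteps.
    rewrite ler_pdivrMr ?exprn_gt0// /q' exprMn exprVn => /le_trans; apply.
    rewrite -[X in _ <= X]mulr1 le_eqVlt; apply/orP; left; apply/eqP.
    by field; rewrite !expf_neq0 ?mulf_neq0 ?gt_eqF ?exprn_gt0.
  have gqq : g q' <= g q by apply: (gauge_le gg) => //; exact: ltW q'0.
  apply: (@le_trans _ _ (2 / a * (overlap * h (r i)))).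
    by rewrite ler_wpM2l// divr_ge0// ltW.
  have D0 : 0 < (2 * b%:R : R) ^+ d by rewrite exprn_gt0// mulr_gt0.
  rewrite -(ler_pM2l D0); apply: (@le_trans _ _ (W * g (r i `^ t))).
    rewrite -ler_pdivrMl// mulrC; apply: le_trans g2i.
    by rewrite le_eqVlt; apply/orP; left; apply/eqP; field; rewrite !gt_eqF.
  rewrite mulrCA ler_pM2l//; apply: le_trans gq' _.
  by rewrite ler_pM2l.
have small i : i \in T -> inQ i -> r i <= 2 * q.
  move=> iT iQ; have /hasPn/(_ _ iT) := big; rewrite iQ /= -leNgt//.
pose T' := [seq i <- T | inQ i].
pose z := x i1 - v.
have i1q : inQ i1 by exact: i1Q.
(* Any centre in Q serves as reference: a trace point is within r_i + q <= 3q of [z], after undoing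
   the translation by [v]. *)
have massQ : \sum_(i <- T | inQ i) fine (m (D i)) <=
    2 * overlap * a * h q / h (c%:R ^- j).
  rewrite -lee_fin; apply: le_trans (mass_cube_le z J1j q0 qe q1 frost).
  rewrite -sumEFin -big_filter -/T'; under eq_bigr do rewrite fineK ?bmeasure_fin_num//.
  apply: measure_seq_disjoint => //.
  - exact: filter_uniq.
  - exact: bmeasurableI mA (bmeasurable_ball _ _).
  - move=> i; rewrite mem_filter => /andP[iQ iT] y /DA[Ay /= yi]; split => //=.
    rewrite /z opprB addrA; apply: le_trans (ler_distD (x i) _ _) _.
    have := small i iT iQ; have := ltW (cube_dist b0 (inQx _ iQ) (inQx _ i1q)).
    by rewrite -/q; move: yi; lra.
  - move=> i l' y; rewrite !mem_filter => /andP[_ iT] /andP[_ lT]; exact: disD.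
apply: (@le_trans _ _ (2 / a * (2 * overlap * a * h q / h (c%:R ^- j)))).
  by rewrite ler_wpM2l// divr_ge0// ltW.
apply: le_trans (hW q q0 ql); rewrite le_eqVlt; apply/orP; left; apply/eqP.
by field; rewrite !gt_eqF ?h_gt0.
Qed.

(** Averages copies of one piece over the [CU] subcubes of generation l. A finer Q meets a single
    copy, whose bound W * g(q), divided by CU, is exactly g(q)/g(sn). A coarser Q receives its share
    of volume. *)
Lemma hitting_tail_mass n K n0 : (b%:R : R) ^- n < eps_gauge d g ->
  cube b n K `<=` hcube -> mass_property b g (hitting_tail n0) n K.
Proof.
move=> neps Ksub; set sn : R := b%:R ^- n in neps.
have sn0 : 0 < sn by exact: side_gt0.
have sn1 : sn <= 1 by rewrite /sn -[leRHS]invr1 -[X in _ <= X^-1](expr0 b%:R) side_le.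
have gn0 : 0 < g sn := gauge_gt0 gg sn0 neps.
have bR0 : 0 < (b%:R : R) by rewrite ltr0n.
have bR1 : 1 <= b%:R :> R by rewrite ler1n.
have ov0 : 0 < overlap := lt_le_trans ltr01 overlap_ge1.
pose e1 := eh / 2; have e10 : 0 < e1 by rewrite divr_gt0.
have e1h : e1 < eh by rewrite /e1; move: eh_gt0; lra.
(* Solves the inequality required by [hW]: W = (sn/sl)^d / g(sn), and sl^d / h(c^-j) is at most
   (4b)^d * e1^d / h(e1) since r^d / h(r) is nondecreasing. So [K1] depends on neither j nor l, and
   these may be chosen afterwards. *)
pose K1 : R := 4 * overlap * ((4 * b%:R) ^+ d * (e1 ^+ d / h e1)) / sn ^+ d * g sn.
have [e2 e20 g2] := g_large K1.
pose D := Num.min (Num.min eh e2) sn.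
have D0 : 0 < D by rewrite !lt_min eh_gt0 e20.
have bb0 : 0 < 4 * b%:R :> R by rewrite mulr_gt0.
have [J' hJ'] := side_small c1 (divr_gt0 D0 bb0).
pose J1 := maxn J J'.
have [j [k [J1j A0 frost]]] := frostman_choice c1 (fun n => h_gt0 (side_gt0 n c0))
  mG G_hcube G_gt0 (fun n k' Jn => G_le k' (leq_trans (leq_maxl J J') Jn)).
have cj0 := @side_gt0 R c j c0.
have bcD : 4 * b%:R * (c%:R : R) ^- j < D.
  rewrite mulrC -ltr_pdivlMr//; apply: le_lt_trans hJ'.
  by rewrite side_le// (leq_trans (leq_maxr J J')).
have := bcD; rewrite !lt_min => /andP[/andP[bc1 bc2] bc3].
have cb : 4 * (c%:R : R) ^- j <= 4 * b%:R * (c%:R : R) ^- j.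
  by rewrite ler_wpM2r ?(ltW cj0)//; move: bR1; lra.
have [||l [lj jl]] := @side_between_gt R b (4 * c%:R ^- j) b1.
- by rewrite mulr_gt0.
- by apply: le_trans sn1; apply: le_trans cb _; exact: ltW.
set sl : R := b%:R ^- l in lj jl.
have sl0 : 0 < sl by exact: side_gt0.
rewrite mulrCA mulrA in jl.
have nl : (n <= l)%N.
  by rewrite -(@side_leE R _ _ _ b1) ltW// (lt_trans jl).
pose CU : R := (b ^ ((l - n) * d))%N%:R.
have CU0 : 0 < CU by rewrite ltr0n expn_gt0 b0.
have CUE : CU = (sn / sl) ^+ d.
  rewrite /CU expnM natrX natrX; congr (_ ^+ _).
  by rewrite /sn /sl invrK -[in RHS](subnK nl) exprD mulrC mulfK// expf_neq0 ?gt_eqF.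
pose W := CU / g sn.
have W0 : 0 < W by rewrite divr_gt0.
have je1 : (c%:R : R) ^- j <= e1.
  have : 4 * (c%:R : R) ^- j < eh := le_lt_trans cb bc1.
  by rewrite /e1; move: cj0; lra.
have hW q : 0 < q -> q <= sl -> 4 * overlap * h q / h (c%:R ^- j) <= W * g q.
  move=> q0 ql; have [g2q _] := g2 q q0 (le_lt_trans ql (lt_trans jl bc2)).
  have hj0 := h_gt0 cj0; have he0 := h_gt0 e10.
  have [_ hr] := h_reg cj0 je1 e1h.
  have slh : sl ^+ d / h (c%:R ^- j) <= (4 * b%:R) ^+ d * (e1 ^+ d / h e1).
    apply: (@le_trans _ _ ((4 * b%:R) ^+ d * ((c%:R ^- j) ^+ d / h (c%:R ^- j)))).
      rewrite mulrA -exprMn ler_pM2r ?invr_gt0//.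
      by apply: lerXn2r; rewrite ?nnegrE ?mulr_ge0 ?(ltW sl0) ?(ltW jl) ?(ltW cj0).
    rewrite ler_pM2l ?exprn_gt0// -[_ / h (c%:R ^- j)]invf_div -[_ / h e1]invf_div.
    by rewrite lef_pV2 ?posrE ?divr_gt0 ?exprn_gt0.
  have sld : 0 < sl ^+ d by rewrite exprn_gt0.
  have snd : 0 < sn ^+ d by rewrite exprn_gt0.
  apply: (@le_trans _ _ (W * (K1 * h q))); last by rewrite ler_pM2l.
  have -> : 4 * overlap * h q / h (c%:R ^- j) =
    4 * overlap * h q / sl ^+ d * (sl ^+ d / h (c%:R ^- j)).
    by field; rewrite !gt_eqF.
  have -> : W * (K1 * h q) = 4 * overlap * h q / sl ^+ d *
      ((4 * b%:R) ^+ d * (e1 ^+ d / h e1)).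
    by rewrite /W /K1 CUE expr_div_n; field; rewrite !gt_eqF.
  by rewrite ler_wpM2l// !mulr_ge0 ?invr_ge0 ?(ltW ov0) ?(ltW sld) ?(ltW (h_gt0 q0)).
have sleh : sl < eh by exact: lt_trans jl bc1.
have sleps : sl < eps_gauge d g by apply: lt_trans neps; exact: lt_trans jl bc3.
have fam (u : 'rV['I_(b ^ (l - n))]_d) := @local_family J1 j k l _ n0 W J1j A0 frost lj sleh sleps W0 hW
  (subset_trans (@subcube_sub R d b n l K b0 nl u) Ksub).
have {fam} [Zf ZfP] := choice fam.
exists [seq (z.1, z.2 / CU) | u <- index_enum _, z <- Zf u]; split.
- rewrite big_allpairs_dep /=.
  under eq_bigr => u _.
    rewrite -mulr_suml; have [-> _ _ _] := ZfP u; over.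
  rewrite sumr_const card_mx card_ord mul1n -mulr_natl -expnM div1r mulfV//.
  by rewrite gt_eqF.
- move=> _ /allpairsPdep[u [z [_ zZ ->]]] /=; have [_ Z0 _ _] := ZfP u.
  by rewrite divr_ge0 ?Z0// ltW.
- move=> _ /allpairsPdep[u [z [_ zZ ->]]] /=; have [_ _ /(_ _ zZ)[lz sub] _] := ZfP u.
  split; first exact: leq_ltn_trans nl lz.
  by move=> y /sub[]; split => //; exact: (@subcube_sub R d b n l K b0 nl u).
move=> n' k' nn' sub'.
move=> [_ /allpairsPdep[u1 [z1 [_ z1Z ->]]] /= z1Q].
have n'eps : b%:R ^- n' < eps_gauge d g by apply: le_lt_trans neps; rewrite side_le.
have gn'0 := gauge_gt0 gg (side_gt0 n' b0) n'eps.
pose inQ (z : 'rV[R]_d * nat * R) := `[< cube_at b z.1.2 z.1.1 `<=` cube b n' k' >].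
have inQx z : inQ z -> cube b n' k' z.1.1.
  by move=> /asboolP; apply; exact: cube_self.
have Zx u z : z \in Zf u -> cube b l (@subcube d b n l K u) z.1.1.
  move=> zZ; have [_ _ /(_ _ zZ)[_ sub] _] := ZfP u.
  by have [] // := sub z.1.1; rewrite /= subrr normr0 ltW// side_gt0.
rewrite big_mkcond big_allpairs_dep /=.
have sumE u : \sum_(z <- Zf u) (if `[< cube_at b z.1.2 z.1.1 `<=` cube b n' k' >]
    then z.2 / CU else 0) = (\sum_(z <- Zf u | inQ z) z.2) / CU.
  by rewrite -big_mkcond mulr_suml.
under eq_bigr do rewrite sumE.
have [ln'|n'l] := leqP l n'.
  have Q1 : cube b n' k' `<=` cube b l (@subcube d b n l K u1).
    by apply: cube_nested (Zx _ _ z1Z) (z1Q _ (cube_self _ _ b0)).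
  rewrite (bigD1 u1)//= [X in _ + X <= _]big1 ?addr0; last first.
    move=> u uu1; rewrite big_seq_cond big1 ?mul0r// => z /andP[zZ zQ].
    have := cube_inj b0 (Zx _ _ zZ) (Q1 _ (inQx _ zQ)).
    by move=> /subcube_inj E; rewrite E eqxx in uu1.
  have [_ _ _ /(_ n' k' ln')] := ZfP u1.
  move=> /(_ (ex_intro2 _ _ z1 z1Z z1Q)) h1.
  rewrite ler_pdivrMr//; apply: le_trans h1 _.
  by rewrite le_eqVlt; apply/orP; left; apply/eqP; rewrite /W; field; rewrite !gt_eqF.
pose inT u := `[< cube b l (@subcube d b n l K u) `<=` cube b n' k' >].
apply: (@le_trans _ _ (\sum_u (if inT u then CU^-1 else 0))).
  apply: ler_sum => u _; have [Z1 Z0 _ _] := ZfP u.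
  case: ifPn => [_|nT].
    rewrite -[leRHS]mul1r ler_pM2r ?invr_gt0// -Z1.
    rewrite [leRHS](bigID inQ)/= lerDl big_seq_cond; apply: sumr_ge0 => z /andP[zZ _].
    exact: Z0.
  rewrite big_seq_cond big1 ?mul0r// => z /andP[zZ zQ].
  case/asboolPn: nT; exact: cube_nested (ltnW n'l) (inQx _ zQ) (Zx _ _ zZ).
(* At most b^((l - n') * d) subcubes lie in Q, a fraction at most (s_n'/s_n)^d of all of them; this
   is at most g(s_n')/g(s_n) because g(r)/r^d is nonincreasing. *)
rewrite -big_mkcond sumr_const -mulr_natl ler_pdivrMr//.
apply: (@le_trans _ _ (b ^ ((l - n') * d))%N%:R).
  by rewrite ler_nat; exact: card_subcube (ltnW n'l).
rewrite expnM natrX natrX CUE.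
have E : (b%:R : R) ^+ (l - n') = b%:R ^- n' / sl.
  by rewrite /sl invrK -[in RHS](subnK (ltnW n'l)) exprD mulrC mulfK// expf_neq0 ?gt_eqF.
rewrite E !expr_div_n mulrA ler_pM2r ?invr_gt0 ?exprn_gt0//.
have s'd : 0 < ((b%:R : R) ^- n') ^+ d by rewrite exprn_gt0// side_gt0.
have snd : 0 < sn ^+ d by rewrite exprn_gt0.
have := gauge_ratio_le gg (side_gt0 n' b0) (side_le b0 nn') neps.
rewrite -/sn ler_pdivrMr// mulrAC ler_pdivlMr// mulrC => h1.
by rewrite mulrAC ler_pdivlMr.
Qed.

End OneStep.

(** * Large intersection *)

Section InfinitelyOften.
Context {R : realType} {d : nat}.

Lemma infinite_natP (T : Type) (e : T -> nat) (A : set T) : injective e ->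
  infinite_set A <-> forall N, exists2 a, A a & (N <= e a)%N.
Proof.
move=> e_inj; split=> [infA N|hA finA].
  apply: contrapT => /forall2NP none; apply: infA.
  apply: (@sub_finite_set _ _ (e @^-1` `I_N)).
    by move=> a Aa /=; have [//|/negP] := none a; rewrite -ltnNge.
  by apply: finite_preimage; [move=> a a' _ _; exact: e_inj|exact: finite_II].
have [s sE] := (finite_seqP _).1 (finite_image e finA).
have [a Aa] := hA (\sum_(i <- s) i).+1.
apply/negP; rewrite -leqNgt.
have : e a \in s by have : [set` s] (e a) by rewrite -sE; exists a.
by move=> eas; rewrite (big_rem _ eas)/= leq_addr.
Qed.

(** The condition on [C] is closedness, so [C] is the intersection of its open
    1/(N+1)-neighbourhoods; infinitely many means indices with arbitrarily large code, again a
    countable intersection of open sets. *)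
Lemma Gdelta_infinitely_often (T : Type) (e : T -> nat) (C : set 'rV[R]_d)
    (S : set T) (a : T -> 'rV[R]_d) (rho : T -> R) : injective e ->
  (forall x, (forall e, 0 < e -> exists2 y, C y & `|x - y| < e) -> C x) ->
  Gdelta [set x | C x /\ infinite_set [set i | S i /\ `|x - a i| < rho i]].
Proof.
move=> e_inj Ccl.
pose nb (z : 'rV[R]_d) s : set 'rV[R]_d := [set x | `|x - z| < s].
have onb z s : open (nb z s).
  rewrite (_ : nb z s = ball z s); first exact: ball_open.
  by apply/seteqP; split=> y; rewrite -ball_normE /nb /= distrC.
exists (fun N => (\bigcup_(y in C) nb y N.+1%:R^-1) `&`
  \bigcup_(i in [set i | S i /\ (N <= e i)%N]) nb (a i) (rho i)).
  by move=> N; apply: openI; apply: bigcup_open => *; exact: onb.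
apply/seteqP; split=> x.
  move=> [Cx /(infinite_natP _ e_inj) inf] N _; split.
    by exists x => //; rewrite /nb /= subrr normr0.
  by have [i [Si xi] Ni] := inf N; exists i.
move=> h; split.
  apply: Ccl => s s0; have [N hN] : exists N, N.+1%:R^-1 < s.
    exists (Num.truncn s^-1); rewrite invf_plt ?posrE//; exact: truncnS_gt.
  by have [[y Cy xy] _] := h N I; exists y => //; exact: lt_trans hN.
apply/(infinite_natP _ e_inj) => N; have [_ [i [Si Ni] xi]] := h N I.
by exists i.
Qed.

End InfinitelyOften.

Section LargeIntersectionOfUbiquity.
Context {R : realType} {d : nat}.
Variables (b : nat) (g : R -> R) (O : nat -> set 'rV[R]_d).
Hypothesis d0 : (0 < d)%N.
Hypothesis b1 : (1 < b)%N.
Hypothesis gg : gauge d g.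
Hypothesis massO : forall n k n0, (b%:R : R) ^- n < eps_gauge d g ->
  cube b n k `<=` (hcube : set 'rV[R]_d) -> mass_property b g (O n0) n k.

Let b0 : (0 < b)%N := ltnW b1.
Local Notation cube := (@cube R d).

Lemma cube_in_translate n k : exists p, cube b n (k - b%:Z ^+ n *: p) `<=` hcube.
Proof.
have [x kx] := @cube_nonempty R d b n k b0.
pose p : 'rV[int]_d := map_mx (fun u => Num.floor u) x; exists p.
have kx' : cube b n (k - b%:Z ^+ n *: p) (x - zvec p).
  by apply/(cube_shift n _ p _ b0); rewrite !subrK.
apply: cube_sub_hcube kx' _ => // i; rewrite !mxE.
by have /andP[h1 h2] := floor_itv (x ord0 i); rewrite subr_ge0 h1 ltrBlDl -intrD1.
Qed.

(** Masses exist only inside the unit cube, so the cube and the cover are translated by an integer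
    vector, which permutes the b-adic cubes of each generation and preserves their prices. This
    treats the periodic and non-periodic sets together. *)
Lemma net_premeasure_full (F U : set 'rV[R]_d) : open U ->
  (forall p x, U x -> hcube (x - zvec p) -> (forall N, O N (x - zvec p)) -> F x) ->
  net_premeasure b g (F `&` U) = net_premeasure b g U.
Proof.
move=> oU sF; have [L hL] := net_generation b1 gg.
have [g0 _] := gg.
have gn0 n : (L <= n)%N -> 0 < g (b%:R ^- n).
  by rewrite -hL; apply: gauge_gt0 => //; exact: side_gt0.
apply: (net_premeasure_restrict d0 b1 gg hL oU) => Q Qcube QF n k Ln kU.
pose u i := (g (diam (Q i)))%:E; rewrite -/u.
have u_ge0 i : (0 <= u i)%E.
  rewrite lee_fin; have [->|[n' [k' [Ln' ->]]]] := Qcube i; first by rewrite diam_set0 g0.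
  by rewrite diam_cube// ltW// gn0.
have [p ksub] := cube_in_translate n k.
pose Q' i := (fun y : 'rV[R]_d => y + zvec p) @^-1` Q i.
have Q'E i n' k' : Q' i = cube b n' k' <-> Q i = cube b n' (k' + b%:Z ^+ n' *: p).
  split=> E; apply/seteqP; split=> y.
  - move=> Qy; have : Q' i (y - zvec p) by rewrite /Q' /= subrK.
    by rewrite E -{2}(subrK (zvec p) y) => ?; apply/cube_shift.
  - rewrite -{1}(subrK (zvec p) y) => /(cube_shift _ _ _ _ b0); rewrite -E.
    by rewrite /Q' /= subrK.
  - by rewrite /Q' /= E => /(cube_shift _ _ _ _ b0).
  - by move=> ?; rewrite /Q' /= E; apply/cube_shift.
have Q'cube i : Q' i = set0 \/ exists n k, (L <= n)%N /\ Q' i = cube b n k.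
  have [E|[n' [k' [Ln' E]]]] := Qcube i; first by left; rewrite /Q' E preimage_set0.
  right; exists n', (k' - b%:Z ^+ n' *: p); split => //.
  by apply/Q'E; rewrite subrK.
have u0 i : Q' i = set0 -> u i = 0%E.
  move=> E; rewrite /u (_ : Q i = set0) ?diam_set0 ?g0//.
  rewrite -subset0 => y Qy; have : Q' i (y - zvec p) by rewrite /Q' /= subrK.
  by rewrite E.
have u_cube i n' k' : Q' i = cube b n' k' -> u i = (g (side b n'))%:E.
  by move=> /Q'E E; rewrite /u E diam_cube.
have [||n' [k' [[Ln' gk'] sub]]] := limsup_covered b1 gn0 Q'cube u_ge0 u0 u_cube
  (O := O) (n0 := n) (k0 := k - b%:Z ^+ n *: p) Ln.
- by move=> N n1 k1 Ln1 sub1; apply: massO; [rewrite hL|exact: subset_trans ksub].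
- move=> y [Oy ky].
  have Uy : U (y + zvec p).
    by apply: kU; rewrite -[k](subrK (b%:Z ^+ n *: p)); exact/cube_shift.
  have [|i _ Qi] := QF (y + zvec p); last by exists i.
  split => //; apply: (sF p) => //; rewrite addrK; first exact: ksub.
  by move=> N; exact: Oy.
exists n', (k' + b%:Z ^+ n' *: p); split.
  split => //; apply: le_trans gk' _; apply: lee_nneseries => [i _ _|i _].
    by case: ifP => // _; exact: u_ge0.
  case: asboolP => [Qi|_]; last by case: ifP => // _; exact: u_ge0.
  rewrite asboolT// => y Qy; rewrite -(subrK (zvec p) y); apply/cube_shift => //.
  by apply: Qi; rewrite /Q' /= subrK.
move=> y; rewrite -{1}(subrK (b%:Z ^+ n *: p) k) -{1}(subrK (zvec p) y).
move=> /(cube_shift _ _ _ _ b0)/sub; rewrite -{2}(subrK (zvec p) y) => ?.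
exact/cube_shift.
Qed.

End LargeIntersectionOfUbiquity.

Section UbiquitousSystem.
Context {R : realType} {d : nat} {I : Type}.
Variables (xs : I -> 'rV[R]_d) (rs : I -> R).
Variable mu : {finite_measure set (borel R d) -> \bar R}.
Variables (alpha beta : R) (phi : R -> R).
Hypothesis d0 : (0 < d)%N.
Hypothesis alpha_gt0 : 0 < alpha.
Hypothesis beta_range : 0 < beta <= d%:R.
Hypothesis phiP : PhiClass phi.
Hypothesis hxr : heterogeneous_ubiquitous xs rs mu alpha beta phi.
Variables (e : I -> nat) (f : nat -> I).
Hypothesis efK : cancel e f.
Hypothesis feK : cancel f e.

Let e_inj : injective e := can_inj efK.

Lemma ccube_closed (x : 'rV[R]_d) :
  (forall s, 0 < s -> exists2 y, ccube y & `|x - y| < s) -> ccube x.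
Proof.
move=> h i; apply/andP; split; apply/ler_addgt0Pr => s /h[y /(_ i)/andP[y0 y1] xy].
  have := le_lt_trans (coord_le_norm _ i) xy; rewrite !mxE ltr_norml.
  by move=> /andP[+ _]; lra.
have := le_lt_trans (coord_le_norm _ i) xy; rewrite !mxE ltr_norml.
by move=> /andP[_]; lra.
Qed.

Lemma limsup_cube_Gdelta M psi t : Gdelta (limsup_cube xs rs mu alpha M psi t).
Proof.
exact: (@Gdelta_infinitely_often R d I e ccube (scaling_indices xs rs mu alpha M psi)
  xs (fun i => rs i `^ t) e_inj ccube_closed).
Qed.

Lemma limsup_per_Gdelta M psi t : 0 < t -> Gdelta (limsup_per xs rs mu alpha M psi t).
Proof.
move=> t0; have [nf _] := hxr; rewrite limsup_perE//.
pose e2 (ip : I * 'rV[int]_d) := pickle (e ip.1, ip.2).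
have e2_inj : injective e2.
  by move=> [i p] [j q] /(pcan_inj pickleK)[/e_inj -> ->].
have := @Gdelta_infinitely_often R d _ e2 setT
  [set ip | scaling_indices xs rs mu alpha M psi ip.1]
  (fun ip => zvec ip.2 + xs ip.1) (fun ip => rs ip.1 `^ t) e2_inj (fun _ _ => Logic.I).
congr Gdelta; apply/seteqP; split=> y /=.
  by move=> [_]; apply: contra_not; apply: sub_finite_set => -[i p] /=; rewrite opprD addrA.
move=> inf; split=> //; apply: contra_not inf.
by apply: sub_finite_set => -[i p] /=; rewrite opprD addrA.
Qed.

(** [psi] and [M] come from the system alone, before [b], [g], [t] and [phi2], so one choice serves
    every gauge and every t. *)
Lemma ubiquity_mass : exists psi M, [/\ PsiClass psi, 1 <= M &
  forall b g t phi2, (1 < b)%N -> gauge d g -> 1 <= t ->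
    (exists2 s, 0 < s & forall r, 0 < r -> r < s -> phi r <= phi2 r) ->
    gauge_prec g (hgauge (beta / t) phi2) ->
    forall n k n0, (b%:R : R) ^- n < eps_gauge d g ->
      cube b n k `<=` (hcube : set 'rV[R]_d) ->
      mass_property b g (hitting_tail (fun i => xs (f i)) (fun i => rs (f i))
        (fun i => scaling_indices xs rs mu alpha M psi (f i)) t n0) n k].
Proof.
have [nf [psi [m [c [psiP um c1 [inf_ae heavy_ae scale_ae dil]]]]]] := hxr.
have [xsr rs0] := nf.
have [M M1 good_ae] := scaling_ae d0 c1 alpha_gt0 psiP nf inf_ae scale_ae.
exists psi, M; split => // b g t phi2 b1 gg t1 phi12 prec n k n0 neps ksub.
have [J [G [mG Gh G0 Gle]]] := frostman_set d0 c1 um heavy_ae.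
have [N [mN N0 badN]] := good_ae.
have [eh eh0 hreg] := hgauge_regular beta_range phiP.
have beta0 : 0 < beta by case/andP: beta_range.
have large := gauge_prec_large beta0 t1 phiP phi12 prec.
apply: (@hitting_tail_mass R d m c (hgauge beta phi) eh J G N _ _ _ t d0 c1) => //.
- by move=> s; exact: hgauge_gt0.
- by move=> i; have [] := xsr (f i).
- move=> y oy Ny i0 delta delta0.
  have inf : infinite_set [set i | scaling_indices xs rs mu alpha M psi i /\
      `|y - xs i| <= rs i / 2].
    by apply: contrapT => fin; apply: Ny; apply: badN => /= /(_ oy).
  apply: contrapT => /forallNP none; apply: inf.
  apply: (@sub_finite_set _ _ ([set i | delta < rs i] `|` f @` `I_i0)); last first.
    by rewrite finite_setU; split; [exact: rs0|apply: finite_image; exact: finite_II].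
  move=> i [si yi]; have [ii|ii] := leqP i0 (e i); last by right; exists (e i).
  left => /=; rewrite ltNge; apply/negP => ri; apply: (none (e i)).
  by rewrite efK.
Qed.

Lemma ubiquity_large_intersection : exists psi M, [/\ PsiClass psi, 1 <= M &
  forall b t phi2, (1 < b)%N -> 1 <= t ->
    (exists2 s, 0 < s & forall r, 0 < r -> r < s -> phi r <= phi2 r) ->
    large_intersection b (hgauge (beta / t) phi2) ocube
      (limsup_cube xs rs mu alpha M psi t) /\
    large_intersection b (hgauge (beta / t) phi2) setT
      (limsup_per xs rs mu alpha M psi t)].
Proof.
have [psi [M [psiP M1 mass]]] := ubiquity_mass.
exists psi, M; split => // b t phi2 b1 t1 phi12.
have t0 : 0 < t by exact: lt_le_trans t1.
have hits x : (forall N, hitting_tail (fun i => xs (f i)) (fun i => rs (f i))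
    (fun i => scaling_indices xs rs mu alpha M psi (f i)) t N x) -> hcube x ->
    limsup_cube xs rs mu alpha M psi t x.
  move=> hx cx; split; first by move=> i; have /andP[-> /ltW ->] := cx i.
  apply/(infinite_natP _ e_inj) => N; have [i [Ni si xi]] := hx N.
  by exists (f i); rewrite ?feK.
split; split.
- exact: limsup_cube_Gdelta.
- move=> g gg prec U oU Uo; apply: (net_premeasure_full d0 b1 gg) => //.
    by move=> n k n0; exact: mass b1 gg t1 phi12 prec n k n0.
  move=> p x Ux hx tx.
  (* Both x and x - p lie in the half-open unit cube, so every coordinate of p is an integer
     strictly between -1 and 1. *)
  have p0 : p = 0.
    apply/rowP => i; have /andP[x0 x1] := Uo _ Ux i.
    have := hx i; rewrite !mxE => /andP[h1 h2].
    have : (p ord0 i)%:~R < 1%:~R :> R by rewrite -[1%:~R]/(1 : R); lra.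
    have : (-1)%:~R < (p ord0 i)%:~R :> R by rewrite rmorphN/= -[1%:~R]/(1 : R); lra.
    by rewrite !ltr_int; move: (p _ _) => z; clear; lia.
  have z0 : x - zvec p = x by rewrite p0; apply/rowP => i; rewrite !mxE subr0.
  by rewrite z0 in hx tx; exact: hits.
- exact: limsup_per_Gdelta.
- move=> g gg prec U oU _; apply: (net_premeasure_full d0 b1 gg) => //.
    by move=> n k n0; exact: mass b1 gg t1 phi12 prec n k n0.
  move=> p x Ux hx tx; exists p => //; exists (x - zvec p); first exact: hits.
  by rewrite addrC subrK.
Qed.

End UbiquitousSystem.

Theorem theorem2 (R : realType) (d : nat) (hd : (0 < d)%N)
    (I : Type) (hI : [set: I] #= [set: nat])
    (xs : I -> 'rV[R]_d) (rs : I -> R)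
    (mu : {finite_measure set (borel R d) -> \bar R})
    (alpha beta : R) (phi : R -> R)
    (hmu : ubiq_measure mu) (halpha : 0 < alpha) (hbeta : 0 < beta <= d%:R)
    (hphi : PhiClass phi)
    (hxr : heterogeneous_ubiquitous xs rs mu alpha beta phi) :
  exists (psi : R -> R) (M : R),
    [/\ PsiClass psi, 1 <= M &
      forall c : nat, (2 <= c)%N ->
        (large_intersection c (hgauge beta phi) ocube
           (limsup_cube xs rs mu alpha M psi 1) /\
         large_intersection c (hgauge beta phi) [set: 'rV[R]_d]
           (limsup_per xs rs mu alpha M psi 1)) /\
        forall t : R, 1 <= t -> forall phi' : R -> R, PhiClass phi' ->
          large_intersection c
            (hgauge (beta / t) (fun r => 2 * phi r + phi' r)) ocube
            (limsup_cube xs rs mu alpha M psi t) /\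
          large_intersection c
            (hgauge (beta / t) (fun r => 2 * phi r + phi' r)) [set: 'rV[R]_d]
            (limsup_per xs rs mu alpha M psi t)].
Proof.
have /card_set_bijP[e [_ e_inj e_surj]] := hI.
have /choice[f feK] : forall n, exists i, e i = n.
  by move=> n; have [i _ <-] := e_surj n Logic.I; exists i.
have efK : cancel e f.
  by move=> i; apply: e_inj; rewrite ?inE// feK.
have [psi [M [psiP M1 H]]] :=
  ubiquity_large_intersection hd halpha hbeta hphi hxr efK feK.
exists psi, M; split => // c c1; split.
  by rewrite -[X in hgauge X](divr1 beta); apply: H => //; exists 1.
move=> t t1 phi' phi'P; apply: H => //.
have [s1 s10 phi0] := PhiClass_ge0 hphi; have [s2 s20 phi'0] := PhiClass_ge0 phi'P.
(* Near zero [phi] and [phi'] are nonnegative, hence phi <= 2 phi + phi', the comparison that [H]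
   asks for. *)
exists (Num.min s1 s2); first by rewrite lt_min s10.
move=> r r0; rewrite lt_min => /andP[r1 r2].
by have := phi0 r r0 r1; have := phi'0 r r0 r2; lra.
Qed.
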